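(* Fix positive real numbers $c$ and $\alpha$ and suppose $f:\mathbb{N}\to\mathbb{N}$ is strictly increasing and satisfies $\lim_{n\to\infty} n^{-\alpha} f(n) = c$. (a) If $\alpha = 1$ and $c \ge 1$, then $P(\mathcal{G}(f)) = [1/(2c^2), 1]$. (c) If $\alpha = 3/2$, then $P(\mathcal{G}(f)) = [0, (1+\sqrt{6}\,c)^{-2}]$.
   Context: Here $\mathbb{N}=\{1,2,\dots\}$. For a strictly increasing function $f:\mathbb{N}\to\mathbb{N}$, let $G_n$ be the grid graph with vertex set $[-f(n),f(n)]^2 \cap \mathbb{Z}^2$, with edges joining pairs of vertices at $L_1$-distance one, and let $\mathcal{G}(f) = (G_n, n\ge 1)$. An activator sequence on $\mathcal{G}(f)$ is a sequence $\mathcal{V} = (v_n, n\ge 1)$ with $v_n \in V(G_n)\cup\{\emptyset\}$ for all $n$, and $v_n \ne \emptyset$ for at least one $n$ (the sequence is ''non-empty''). Repeated vertices, and vertices that are already burning, are allowed; $v_n=\emptyset$ means no vertex is activated on turn $n$. The burning process: $B_0=\emptyset$ and, for $n\ge 1$, $B_n$ is the union of $B_{n-1}$, the set of all neighbours in $G_n$ of vertices of $B_{n-1}$, and $\{v_n\}$ if $v_n\neq\emptyset$. Define $\underline{\delta}(\mathcal{G}(f),\mathcal{V}) = \liminf_{n\to\infty} |B_n|/|V(G_n)|$ and $\overline{\delta}(\mathcal{G}(f),\mathcal{V}) = \limsup_{n\to\infty} |B_n|/|V(G_n)|$. If they are equal, the common value is the burning density $\delta(\mathcal{G}(f),\mathcal{V})$.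 Finally, $P(\mathcal{G}(f))$ is the set of $\rho\in[0,1]$ for which there is a (non-empty) activator sequence $\mathcal{V}$ on $\mathcal{G}(f)$ such that $\delta(\mathcal{G}(f),\mathcal{V})$ exists and equals $\rho$. *)

(* Defs.v *)
From HB Require Import structures.
From mathcomp Require Import all_boot all_order all_algebra finmap.
From mathcomp Require Import all_classical all_reals all_analysis.

Set Implicit Arguments.
Unset Strict Implicit.
Unset Printing Implicit Defensive.

Import Order.TTheory GRing.Theory Num.Theory.
Import numFieldNormedType.Exports.

Local Open Scope fset_scope.
Local Open Scope classical_set_scope.
Local Open Scope ring_scope.

(* Indices range over {1, 2, ...}: sequences are functions on [nat] of
   which only the values at positive indices matter. *)

Definition strictly_increasing_pos (f : nat -> nat) : Prop :=
  (forall n, (0 < n)%N -> (0 < f n)%N) /\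
  (forall m n, (0 < m)%N -> (m < n)%N -> (f m < f n)%N).

Definition segment (m : nat) : {fset int} :=
  [fset i%:Z - m%:Z | i in iota 0 (2 * m).+1].

Definition box (m : nat) : {fset int * int} :=
  [fset ((x, y) : int * int) | x in segment m, y in segment m].

Lemma in_segment (m : nat) (x : int) :
  (x \in segment m) = (- m%:Z <= x <= m%:Z).
Proof.
apply/imfsetP/andP => [[i hi ->]|[lx ux]].
  have : i \in iota 0 (2 * m).+1 by [].
  rewrite mem_iota add0n ltnS => /andP[_ {}hi].
  have hi' : (i%:Z <= m%:Z + m%:Z) by rewrite -PoszD lez_nat addnn -mul2n.
  by rewrite lerBrDr addNr lerBlDr.
have x0 : 0 <= x + m%:Z by rewrite -lerBlDr sub0r.
exists `|(x + m%:Z)%R|%N; last by rewrite gez0_abs ?addrK.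
have : `|(x + m%:Z)%R|%N \in iota 0 (2 * m).+1; last by [].
rewrite mem_iota leq0n add0n ltnS -lez_nat gez0_abs //.
by rewrite mul2n -addnn PoszD lerD2r.
Qed.

Lemma in_box (m : nat) (x y : int) :
  ((x, y) \in box m) = (- m%:Z <= x <= m%:Z) && (- m%:Z <= y <= m%:Z).
Proof.
apply/imfset2P/andP => [[a /= ha [b /= hb [-> ->]]]|[hx hy]].
  by rewrite -!in_segment.
by exists x; rewrite /= ?in_segment //; exists y; rewrite /= ?in_segment.
Qed.

Definition dist1 (u w : int * int) : int := `|u.1 - w.1| + `|u.2 - w.2|.

Definition adj (u w : int * int) : bool := dist1 u w == 1.

Definition grid_vertices (f : nat -> nat) (n : nat) : {fset int * int} :=
  box (f n).

Definition grid_neighbours (f : nat -> nat) (n : nat) (B : {fset int * int}) :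
    {fset int * int} :=
  [fset w in grid_vertices f n | has (fun u => adj u w) B]%fset.

(* [None] stands for the empty symbol: no activation on that turn. *)
Definition is_activator_sequence (f : nat -> nat)
    (v : nat -> option (int * int)) : Prop :=
  (forall n x, (0 < n)%N -> v n = Some x -> x \in grid_vertices f n) /\
  (exists2 n, (0 < n)%N & v n <> None).

Definition activated (o : option (int * int)) : {fset int * int} :=
  if o is Some x then [fset x]%fset else fset0.

Fixpoint burned (f : nat -> nat) (v : nat -> option (int * int)) (n : nat) :
    {fset int * int} :=
  if n is k.+1 then
    (burned f v k `|` grid_neighbours f n (burned f v k) `|` activated (v n))%fset
  else fset0.

Section Density.
Variable R : realType.

Definition burned_ratio (f : nat -> nat) (v : nat -> option (int * int))
    (n : nat) : R :=
  #|` burned f v n|%:R / #|` grid_vertices f n|%:R.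

(* The ratios lie in [0, 1] for activator sequences, so the real-valued
   [limn_inf] and [limn_sup] are the genuine lower and upper limits. *)
Definition lower_density f v : R := limn_inf (burned_ratio f v).

Definition upper_density f v : R := limn_sup (burned_ratio f v).

Definition has_burning_density f v (rho : R) : Prop :=
  lower_density f v = rho /\ upper_density f v = rho.

Definition burning_densities (f : nat -> nat) : set R :=
  [set rho | 0 <= rho <= 1 /\
     exists v, is_activator_sequence f v /\ has_burning_density f v rho].

End Density.

Arguments burned_ratio R f v n : clear implicits.
Arguments lower_density R f v : clear implicits.
Arguments upper_density R f v : clear implicits.
Arguments has_burning_density R f v rho : clear implicits.
Arguments burning_densities R f : clear implicits.

(* Main.v *)
Require Import Defs.
From HB Require Import structures.
From mathcomp Require Import all_boot all_order all_algebra finmap.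
From mathcomp Require Import all_classical all_reals all_analysis.
From mathcomp Require Import zify ring lra.
Import Order.TTheory GRing.Theory Num.Theory.
Import numFieldNormedType.Exports.
Local Open Scope classical_set_scope.
Local Open Scope ring_scope.

(** Because [f] is strictly increasing, the box grows at least as fast as the
    fire, so the grid never stops it: the burned set at time [n] is the union
    of the l1-balls of radius [n - m] around the points activated at times
    [m <= n] ([burnedP]).  The theorem is then a question about unions of such
    diamonds, whose areas are all read off from the exact count of lattice
    points in an octagon ([card_octagon]).

    Linear case.  A single ball already has about [2 n^2] points, which gives
    the lower end of the interval.  For the other densities, the octagon
    [|x|, |y| <= u n], [|x| + |y| <= (2 u - d) n] cannot be left by fires lit
    inside it when [u] and [2 u - d] are at least [1] ([region_spread]); its
    area is [(4 u^2 - 2 d^2) n^2], and [u], [d] can be tuned to any density in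
    the interval.  It is almost filled by lighting, in block [j] of length of
    order [j^3] around time [6 j^4], all the points of a mesh of step [j^3]:
    both the mesh and the block length are negligible against the time.

    Order [n^(3/2)].  The fires lit before time [s n] all lie in a box of side
    about [2 c (s n)^(3/2)], and the later ones burn at most the sum of the
    areas of their balls, about [2 (1 - s)^3 n^3 / 3].  The best choice
    [s = 1 / (1 + sqrt 6 c)] gives the upper bound
    ([burned_eventually_le]).  It is attained, for any [a <= c] in place of
    [c], if every fire burns undisturbed until the moment where the bound
    stops counting it separately, that is if there are points [p_k] within
    sup-distance about [a k^(3/2)] whose balls of radius about [sqrt 6 a k]
    are pairwise disjoint: then the burned set has at least as many points as
    the disjoint balls of radius [min (n - k, sqrt 6 a k)]
    ([burned_eventually_ge]).  Such a packing is built from diamond lattices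
    in consecutive square annuli; in the limit it wastes no area.

    In both constructions the ideal activation time of the [k]-th point is
    [k], but the point may lie outside the grid at that time, [f] being known
    only asymptotically.  Postponing the activations as little as possible
    changes the times by a factor tending to [1] ([schedule]). *)


(** * Diamonds, octagons and the burned set *)

Definition sup_norm (p : int * int) : nat := maxn `|p.1| `|p.2|.

Definition l1_norm (p : int * int) : nat := (`|p.1| + `|p.2|)%N.

Definition l1_dist (p q : int * int) : nat := l1_norm (p - q).

Lemma adjE p q : adj p q = (l1_dist p q == 1)%N.
Proof. by case: p q => [a b] [x y]; rewrite /adj /dist1 /l1_dist /l1_norm /=; lia. Qed.

Lemma in_boxE m p : (p \in box m) = (sup_norm p <= m)%N.
Proof. by case: p => x y; rewrite in_box /sup_norm /=; lia. Qed.

Lemma sup_norm_dist p q : (sup_norm p <= sup_norm q + l1_dist p q)%N.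
Proof. by case: p q => [a b] [x y]; rewrite /sup_norm /l1_dist /l1_norm /=; lia. Qed.

Lemma l1_norm_dist p q : (l1_norm p <= l1_norm q + l1_dist p q)%N.
Proof. by case: p q => [a b] [x y]; rewrite /l1_dist /l1_norm /=; lia. Qed.

Lemma l1_dist_triangle p q s : (l1_dist p s <= l1_dist p q + l1_dist q s)%N.
Proof.
by case: p q s => [a b] [x y] [z t]; rewrite /l1_dist /l1_norm /=; lia.
Qed.

Lemma l1_distC p q : l1_dist p q = l1_dist q p.
Proof. by case: p q => [a b] [x y]; rewrite /l1_dist /l1_norm /=; lia. Qed.

Lemma l1_dist_eq0 p q : l1_dist p q = 0%N -> p = q.
Proof.
case: p q => [a b] [x y]; rewrite /l1_dist /l1_norm /= => H.
by congr (_, _); lia.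
Qed.

(** The point [p'] is the neighbour of [p] on a shortest path to [q]; it is
    through such a neighbour that the fire of [q] reaches [p]. *)
Lemma l1_dist_step p q d : l1_dist p q = d.+1 ->
  exists2 p', l1_dist p' q = d & l1_dist p' p = 1%N.
Proof.
case: p q => [a b] [x y]; rewrite /l1_dist /l1_norm /= => H.
case: (ltrP a x) => Hax.
  by exists (a + 1, b) => /=; lia.
case: (ltrP x a) => Hxa.
  by exists (a - 1, b) => /=; lia.
case: (ltrP b y) => Hby.
  by exists (a, b + 1) => /=; lia.
by exists (a, b - 1) => /=; lia.
Qed.

(** Regions symmetric under both reflections are enumerated row by row, so
    that their cardinals follow by induction on the height. *)
Definition grid_row (h : nat) (y : int) : {fset int * int} :=
  [fset (x, y) | x in segment h]%fset.

Lemma card_segment m : #|` segment m| = (2 * m).+1.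
Proof.
rewrite card_imfset; last by move=> i j /= H; lia.
rewrite -[LHS]/(size (undup (iota 0 (2 * m).+1))).
by rewrite undup_id ?iota_uniq // size_iota.
Qed.

Lemma card_grid_row h y : #|` grid_row h y| = (2 * h).+1.
Proof. by rewrite card_imfset /= ?card_segment // => a b [->]. Qed.

Lemma in_grid_row h y (p : int * int) :
  (p \in grid_row h y) = (`|p.1| <= h)%N && (p.2 == y).
Proof.
apply/imfsetP/andP => [[x /=]|[h1 /eqP h2]].
  by rewrite in_segment => hx -> /=; lia.
by exists p.1; rewrite /= ?in_segment; [lia|case: p h1 h2 => a b /= _ ->].
Qed.

Fixpoint rows (h : nat -> nat) (g : nat) : {fset int * int} :=
  if g is k.+1 then
    (rows h k `|` (grid_row (h g) g%:Z `|` grid_row (h g) (- g%:Z)))%fset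
  else grid_row (h 0%N) 0.

Lemma in_rows h g (p : int * int) :
  (p \in rows h g) = (`|p.2| <= g)%N && (`|p.1| <= h `|p.2|%N)%N.
Proof.
case: p => x y; elim: g => [|g IH].
  rewrite /= in_grid_row /=.
  have -> : (`|y| <= 0)%N = (y == 0) by lia.
  by case: eqP => [->|_]; rewrite ?andbT ?andbF ?andTb.
rewrite /= !in_fsetU IH !in_grid_row /=.
case: (ltngtP `|y|%N g.+1) => hy; first by lia.
  by lia.
by rewrite hy; lia.
Qed.

Lemma card_rowsS h g : #|` rows h g.+1| = (#|` rows h g| + 2 * (2 * h g.+1).+1)%N.
Proof.
rewrite /= cardfsU (_ : _ `&` _ = fset0)%fset; last first.
  apply/fsetP => p; rewrite in_fsetI in_fsetU in_rows !in_grid_row in_fset0.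
  by case: p => x y /=; lia.
rewrite cardfsU (_ : _ `&` _ = fset0)%fset; last first.
  apply/fsetP => p; rewrite in_fsetI !in_grid_row in_fset0.
  by case: p => x y /=; lia.
by rewrite cardfs0 !card_grid_row !subn0 addnn -mul2n.
Qed.

(** The box of radius [F] with its four corners cut: diamonds ([D = F]) and
    boxes ([D = 0]) are special cases, so one count serves for all. *)
Definition octagon (F D : nat) : {fset int * int} :=
  rows (fun y => minn F (2 * F - D - y)) F.

Lemma in_octagon F D p : (D <= F)%N ->
  (p \in octagon F D) = (sup_norm p <= F)%N && (l1_norm p <= 2 * F - D)%N.
Proof.
by move=> DF; rewrite in_rows /sup_norm /l1_norm; case: p => x y /=; lia.
Qed.

(** Each cut corner is a triangle with [D (D + 1) / 2] points. *)
Lemma card_octagon F D : (D <= F)%N ->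
  (#|` octagon F D| + 2 * D * D.+1 = (2 * F).+1 ^ 2)%N.
Proof.
move=> DF; rewrite /octagon.
(* At height [g], the row meets the corners in [2 (g + D - F)] points, a
   truncated difference that is [0] below the corners. *)
suff H g : (g <= F)%N ->
    (#|` rows (fun y => minn F (2 * F - D - y)) g| +
      2 * (g + D - F) * (g + D - F).+1 = (2 * F).+1 * (2 * g).+1)%N.
  by have := H F (leqnn F); rewrite addKn; lia.
elim: g => [_|g IH gF].
  rewrite /= card_grid_row; have -> : (0 + D - F = 0)%N by lia.
  have -> : minn F (2 * F - D - 0) = F by lia.
  by lia.
rewrite card_rowsS; move: (#|` _|) (IH (ltnW gF)) => C.
case: (leqP F (g + D)) => h.
  have -> : (g.+1 + D - F = (g + D - F).+1)%N by lia.
  set q := (g + D - F)%N.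
  have -> : minn F (2 * F - D - g.+1) = (F - q.+1)%N by lia.
  have : (q < F)%N by lia.
  by move: q => q qF; move: (F - q.+1)%N (subnKC qF) => s <-; nia.
have -> : (g.+1 + D - F = 0)%N by lia.
have -> : (g + D - F = 0)%N by lia.
have -> : minn F (2 * F - D - g.+1) = F by lia.
by rewrite !muln0; lia.
Qed.

Lemma card_box m : #|` box m| = ((2 * m).+1 ^ 2)%N.
Proof.
rewrite -(@card_octagon m 0) // muln0 addn0; congr #|` _|.
by apply/fsetP => p; rewrite in_boxE in_octagon // /sup_norm /l1_norm; lia.
Qed.

Definition l1_ball (p : int * int) (r : nat) : {fset int * int} :=
  [fset (p + q)%R | q in octagon r r]%fset.

Lemma in_l1_ball p r q : (q \in l1_ball p r) = (l1_dist q p <= r)%N.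
Proof.
apply/imfsetP/idP => [[z /=]|h].
  rewrite in_octagon // => /andP[_ hz] ->.
  by rewrite /l1_dist addrAC subrr add0r; lia.
exists (q - p); last by rewrite addrC subrK.
by rewrite in_octagon //= /l1_dist /sup_norm /l1_norm in h *; lia.
Qed.

Lemma card_l1_ball p r : #|` l1_ball p r| = (2 * r * r.+1).+1.
Proof.
rewrite card_imfset /=; last exact: addrI.
have := @card_octagon r r (leqnn r); move: (size _) => C; rewrite expnS expn1; nia.
Qed.

Lemma card_l1_ball_ge p r : (2 * r ^ 2 <= #|` l1_ball p r|)%N.
Proof. by rewrite card_l1_ball expnS expn1; nia. Qed.

Section BurningProcess.
Variables (f : nat -> nat) (v : nat -> option (int * int)).
Hypothesis incr_f : strictly_increasing_pos f.
Hypothesis act_v : is_activator_sequence f v.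

(** The sides of the grid move at least at the speed of the fire. *)
Lemma increase_ge m n : (0 < m)%N -> (m <= n)%N -> (f m + (n - m) <= f n)%N.
Proof.
move=> m0; elim: n => [|n IH]; first by lia.
rewrite leq_eqVlt => /predU1P[->|]; first by lia.
rewrite ltnS => mn; have := IH mn.
by have [_ /(_ n n.+1)] := incr_f; lia.
Qed.

(** A fire started inside the grid never feels its boundary, by
    [increase_ge]; so fires spread as in the whole plane and simply
    superpose. *)
Lemma burnedP n q :
  reflect (exists m p, [/\ (0 < m <= n)%N, v m = Some p &
                           (l1_dist q p <= n - m)%N])
          (q \in burned f v n).
Proof.
apply: (iffP idP); elim: n q => [|n IH] q /=.
- by rewrite in_fset0.
- rewrite !in_fsetU => /orP[/orP[]|].
  + by move=> /IH[m [p [mn vm qp]]]; exists m, p; split => //; lia.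
  + rewrite !inE /= => /andP[_ /hasP[z /= zB]]; rewrite adjE => /eqP zq.
    have [m [p [mn vm zp]]] := IH z zB.
    exists m, p; split => //; first by lia.
    by have := l1_dist_triangle q z p; rewrite (l1_distC q z); lia.
  + case vE : (v n.+1) => [p|] //=; rewrite inE => /eqP ->.
    exists n.+1, p; split => //; first by lia.
    by rewrite /l1_dist subrr.
- by move=> [m [p [? _ _]]]; lia.
- move=> [m [p [mn vm qp]]]; rewrite !in_fsetU.
  move: mn; rewrite [(m <= _)%N]leq_eqVlt => /andP[m0 /predU1P[mE|]].
    have -> : q = p.
      by apply: l1_dist_eq0; move: qp; rewrite mE subnn leqn0 => /eqP.
    by rewrite -mE vm /= fset11 orbT.
  rewrite ltnS => mn; have [qp'|qp'] := leqP (l1_dist q p) (n - m).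
    by rewrite (IH q) //; exists m, p; rewrite m0 mn.
  have [z zp zq] := @l1_dist_step q p (n - m) ltac:(lia).
  have zB : z \in burned f v n by apply: IH; exists m, p; rewrite m0 mn zp.
  rewrite !inE /=; apply/orP; left; apply/orP; right; apply/andP; split.
    suff : q \in box (f n.+1) by rewrite inE.
    rewrite in_boxE; have := proj1 act_v m p m0 vm; rewrite /grid_vertices in_boxE.
    have := sup_norm_dist q p; have := @increase_ge m n.+1 m0; lia.
  by apply/hasP; exists z => //; rewrite adjE zq.
Qed.

Lemma burned_sub_grid n : (burned f v n `<=` grid_vertices f n)%fset.
Proof.
apply/fsubsetP => q /burnedP[m [p [mn vm qp]]].
have := proj1 act_v m p ltac:(lia) vm; rewrite /grid_vertices !in_boxE.
by have := sup_norm_dist q p; have := @increase_ge m n; lia.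
Qed.

End BurningProcess.

(** * Counting unions, and densities from one-sided asymptotic bounds *)

Section DisjointUnions.
Variable K : choiceType.

Lemma card_cover_le (n : nat) (A : nat -> {fset K}) (S : {fset K}) :
  (forall x, x \in S -> exists2 i, (i < n)%N & x \in A i) ->
  (#|` S| <= \sum_(i < n) #|` A i|)%N.
Proof.
elim: n S => [|n IH] S H.
  rewrite big_ord0 leqn0 cardfs_eq0; apply/eqP/fsetP => x.
  by rewrite in_fset0; apply/negP => /H[].
rewrite big_ord_recr /= -(cardfsID (A n) S) addnC leq_add //; last first.
  exact/fsubset_leq_card/fsubsetIr.
apply: IH => x; rewrite in_fsetD => /andP[xn /H[i]].
rewrite ltnS leq_eqVlt => /predU1P[->|]; first by rewrite (negbTE xn).
by exists i.
Qed.

Lemma card_packing_ge (n : nat) (A : nat -> {fset K}) (S : {fset K}) :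
  (forall i, (i < n)%N -> (A i `<=` S)%fset) ->
  (forall i j x, (i < j < n)%N -> x \in A i -> x \in A j -> False) ->
  (\sum_(i < n) #|` A i| <= #|` S|)%N.
Proof.
elim: n S => [|n IH] S H dis; first by rewrite big_ord0.
rewrite big_ord_recr /= -(cardfsID (A n) S) addnC leq_add //.
  by rewrite (fsetIidPr _) // H.
apply: IH => [i ni|i j x ijn]; last by apply: dis; lia.
apply/fsubsetP => x xi; rewrite in_fsetD (fsubsetP (H i _) _ xi) ?andbT; last lia.
by apply/negP => xn; apply: (dis i n x) => //; lia.
Qed.

End DisjointUnions.

Section Limits.
Variable R : realType.
Implicit Types (u X Y : nat -> R) (L l y : R).

(** One-sided bounds on the upper and the lower limit, in a form that makes
    sense for unbounded sequences and can be proved one slack at a time. *)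
Definition eventually_le u (L : R) :=
  forall l, L < l -> \forall n \near \oo, u n <= l.

Definition eventually_ge u (L : R) :=
  forall l, l < L -> \forall n \near \oo, l <= u n.

Lemma cvg_eventually_le u L : u @ \oo --> L -> eventually_le u L.
Proof.
move=> uL l Ll; near=> n; apply: ltW; near: n.
exact: (cvgr_lt L).
Unshelve. all: by end_near. Qed.

Lemma cvg_eventually_ge u L : u @ \oo --> L -> eventually_ge u L.
Proof.
move=> uL l Ll; near=> n; apply: ltW; near: n.
exact: (cvgr_gt L).
Unshelve. all: by end_near. Qed.

Lemma eventually_cvg u L : eventually_le u L -> eventually_ge u L -> 
  u @ \oo --> L.
Proof.
move=> le ge; apply/cvgrPdist_le => e e0; near=> n.
rewrite ler_distl; apply/andP; split.
  by rewrite lerBlDr; near: n; apply: le; lra.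
by rewrite -lerBlDr; near: n; apply: ge; lra.
Unshelve. all: by end_near. Qed.

Lemma eventually_le_trans u X L : (\forall n \near \oo, u n <= X n) ->
  X @ \oo --> L -> eventually_le u L.
Proof.
move=> uX XL l Ll; near=> n.
apply: (@le_trans _ _ (X n)); near: n => //.
exact: (cvg_eventually_le _ _ XL).
Unshelve. all: by end_near. Qed.

Lemma eventually_ge_trans u X L : (\forall n \near \oo, X n <= u n) ->
  X @ \oo --> L -> eventually_ge u L.
Proof.
move=> uX XL l Ll; near=> n.
apply: (@le_trans _ _ (X n)); near: n => //.
exact: (cvg_eventually_ge _ _ XL).
Unshelve. all: by end_near. Qed.

Lemma eventually_le_div X Y L y : 0 < y -> Y @ \oo --> y ->
  eventually_le X L -> eventually_le (fun n => X n / Y n) (L / y).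
Proof.
move=> y0 Yy XL l; rewrite ltr_pdivrMr // => Ll.
have h1 := XL ((L + l * y) / 2) ltac:(lra).
have h2 : \forall n \near \oo, 0 < Y n by apply: (cvgr_gt y).
have h3 : \forall n \near \oo, (L + l * y) / 2 <= l * Y n.
  apply: (@cvg_eventually_ge _ (l * y)); last by lra.
  by apply: cvgM => //; apply: cvg_cst.
near=> n; have Y0 : 0 < Y n by near: n.
rewrite ler_pdivrMr //; apply: (@le_trans _ _ ((L + l * y) / 2)); by near: n.
Unshelve. all: by end_near. Qed.

Lemma eventually_ge_div X Y L y : 0 < y -> Y @ \oo --> y ->
  eventually_ge X L -> eventually_ge (fun n => X n / Y n) (L / y).
Proof.
move=> y0 Yy XL l; rewrite ltr_pdivlMr // => Ll.
have h1 := XL ((L + l * y) / 2) ltac:(lra).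
have h2 : \forall n \near \oo, 0 < Y n by apply: (cvgr_gt y).
have h3 : \forall n \near \oo, l * Y n <= (L + l * y) / 2.
  apply: (@cvg_eventually_le _ (l * y)); last by lra.
  by apply: cvgM => //; apply: cvg_cst.
near=> n; have Y0 : 0 < Y n by near: n.
rewrite ler_pdivlMr //; apply: (@le_trans _ _ ((L + l * y) / 2)); by near: n.
Unshelve. all: by end_near. Qed.

Lemma limn_sup_le u L : bounded_fun u -> eventually_le u L -> limn_sup u <= L.
Proof.
move=> bu uL; apply/ler_addgt0Pr => e e0.
have [N _ NP] := uL (L + e) ltac:(lra).
rewrite limn_supE //; apply: (@le_trans _ _ (sups u N)).
  apply: ge_inf; last by exists N.
  exact: bounded_fun_has_lbound_sups.
apply: ge_sup; first by exists (u N); exists N => //=.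
by move=> _ [n /= Nn <-]; apply: NP.
Qed.

Lemma limn_inf_ge u L : bounded_fun u -> eventually_ge u L -> L <= limn_inf u.
Proof.
move=> bu uL; apply/ler_addgt0Pr => e e0; rewrite -lerBlDr.
have [N _ NP] := uL (L - e) ltac:(lra).
rewrite limn_infE //; apply: (@le_trans _ _ (infs u N)); last first.
  apply: sup_upper_bound; last by exists N.
  split; first by exists (infs u 0%N); exists 0%N.
  exact: bounded_fun_has_ubound_infs.
apply: lb_le_inf; first by exists (u N); exists N => //=.
by move=> _ [n /= Nn <-]; apply: NP.
Qed.

End Limits.

Arguments eventually_le {R} u L.
Arguments eventually_ge {R} u L.

Section Densities.
Variables (R : realType) (f : nat -> nat) (v : nat -> option (int * int)).
Hypothesis incr_f : strictly_increasing_pos f.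
Hypothesis act_v : is_activator_sequence f v.

Lemma card_grid n : #|` grid_vertices f n|%:R = (2 * (f n)%:R + 1) ^+ 2 :> R.
Proof. by rewrite /grid_vertices card_box -addn1 natrX natrD natrM. Qed.

Lemma burned_ratio_itv n : 0 <= burned_ratio R f v n <= 1.
Proof.
rewrite /burned_ratio divr_ge0 //= ler_pdivrMr.
  by rewrite mul1r ler_nat; apply/fsubset_leq_card/burned_sub_grid.
by rewrite card_grid exprn_gt0 // ltr_wpDl // mulr_ge0.
Qed.

Lemma bounded_burned_ratio : bounded_fun (burned_ratio R f v).
Proof.
exists 1; split => // x x1 n _ /=.
by have /andP[h1 h2] := burned_ratio_itv n; rewrite ger0_norm // (le_trans h2) // ltW.
Qed.

(** Both cardinals are compared with the same power of [n], so that bounds on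
    the burned set transfer to the ratio. *)
Section Scale.
Variables (e : nat) (y L : R).
Hypothesis y_gt0 : 0 < y.
Hypothesis grid_y : (2 * (f n)%:R + 1) ^+ 2 / n%:R ^+ e @[n --> \oo] --> y.

Let ratioE :
  \forall n \near \oo, burned_ratio R f v n =
    (#|` burned f v n|%:R / n%:R ^+ e) / ((2 * (f n)%:R + 1) ^+ 2 / n%:R ^+ e).
Proof.
near=> n; rewrite /burned_ratio card_grid invf_div mulrA divfK //.
by rewrite expf_neq0 // pnatr_eq0 -lt0n; near: n; exists 1%N.
Unshelve. all: by end_near. Qed.

Lemma burned_ratio_le :
  eventually_le (fun n => #|` burned f v n|%:R / n%:R ^+ e : R) L ->
  eventually_le (burned_ratio R f v) (L / y).
Proof.
move=> H l Ll; have := eventually_le_div _ _ _ _ _ y_gt0 grid_y H _ Ll.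
by apply: filterS2 ratioE => n ->.
Qed.

Lemma burned_ratio_ge :
  eventually_ge (fun n => #|` burned f v n|%:R / n%:R ^+ e : R) L ->
  eventually_ge (burned_ratio R f v) (L / y).
Proof.
move=> H l Ll; have := eventually_ge_div _ _ _ _ _ y_gt0 grid_y H _ Ll.
by apply: filterS2 ratioE => n ->.
Qed.

End Scale.

Lemma upper_density_le L : eventually_le (burned_ratio R f v) L ->
  upper_density R f v <= L.
Proof. exact/limn_sup_le/bounded_burned_ratio. Qed.

Lemma lower_density_ge L : eventually_ge (burned_ratio R f v) L ->
  L <= lower_density R f v.
Proof. exact/limn_inf_ge/bounded_burned_ratio. Qed.

Lemma has_density L : eventually_le (burned_ratio R f v) L ->
  eventually_ge (burned_ratio R f v) L -> has_burning_density R f v L.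
Proof.
move=> le ge; have := eventually_cvg _ _ _ le ge.
by move=> /cvg_limn_inf_sup[h1 h2]; split.
Qed.

End Densities.

(** * Scheduling a prescribed sequence of points *)

(** The points [p k] are to be lit in order, one at a time, each as soon as the
    grid contains it. *)
Section Scheduling.
Variables (R : realType) (f : nat -> nat).
Hypothesis incr_f : strictly_increasing_pos f.
Variables (p : nat -> int * int) (g : nat -> nat).
Hypothesis p_le_g : forall k, (sup_norm (p k) <= g k)%N.
Hypothesis g_le_f : forall x : R, 1 < x ->
  \forall k \near \oo, forall m, x * k%:R <= m%:R -> (g k <= f m)%N.

Let entryP k : exists m, (0 < m)%N && (g k <= f m)%N.
Proof.
exists (g k).+1; rewrite ltn0Sn /=.
by have := @increase_ge f incr_f 1 (g k).+1 isT isT; lia.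
Qed.

Let entry k := ex_minn (entryP k).

(** The time is the maximum over [i <= k] of [entry i + (k - i)]; when
    [entry i] is at most [i + o(i)], this is [k + o(k)]. *)
Fixpoint activation_time (k : nat) : nat :=
  if k is l.+1 then maxn (entry k) (activation_time l).+1 else entry 0.

Let entry_le_time k : (entry k <= activation_time k)%N.
Proof. by case: k => [|k] //=; rewrite leq_maxl. Qed.

Let time_gt0 k : (0 < activation_time k)%N.
Proof.
apply: leq_trans (entry_le_time k).
by rewrite /entry; case: ex_minnP => m /andP[].
Qed.

Let timeS k : (activation_time k < activation_time k.+1)%N.
Proof. by rewrite /= leq_maxr. Qed.

Let time_mono : {mono activation_time : k l / (k <= l)%N}.
Proof. exact/leq_mono/(homo_ltn ltn_trans)/timeS. Qed.

Let time_inj : injective activation_time.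
Proof. exact/incn_inj/time_mono. Qed.

Let time_gt k : (k < activation_time k)%N.
Proof. by elim: k => [|k IH] //; apply: leq_ltn_trans IH (timeS k). Qed.

Let time_le x : 1 < x ->
  \forall k \near \oo, (activation_time k)%:R <= x * k%:R :> R.
Proof.
move=> x1; pose y : R := (1 + x) / 2; have y1 : 1 < y by rewrite /y; lra.
have [N _ NP] := g_le_f y y1.
have entry_le k : (N <= k)%N -> (entry k)%:R <= y * k%:R + 1.
  move=> Nk; pose m := (Num.trunc (y * k%:R)).+1.
  have ge0 : 0 <= y * k%:R by rewrite mulr_ge0 //; lra.
  have /andP[m1 m2] := truncn_itv ge0.
  apply: (@le_trans _ _ m%:R); last by rewrite /m -natr1 lerD2r.
  rewrite ler_nat /entry; case: ex_minnP => l _; apply.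
  by rewrite ltn0Sn /=; apply: (NP k Nk); apply: ltW.
pose C : R := (activation_time N).+1%:R.
(* Beyond [N] the entry times stay below the line of slope [y] shifted by [C],
   and a postponement by one step is slower than that line. *)
have H i : (activation_time (N + i))%:R <= y * (N + i)%:R + C.
  have y0 k : 0 <= y * k%:R by rewrite mulr_ge0 //; lra.
  elim: i => [|i IH]; first by have := y0 N; rewrite addn0 /C -natr1; lra.
  rewrite addnS [activation_time _]/=.
  have := entry_le (N + i).+1 ltac:(lia).
  have C1 : 1 <= C by rewrite /C ler1n.
  by rewrite /maxn; case: ifP => _; rewrite -!natr1 mulrDr; lra.
near=> k; have Nk : (N <= k)%N by near: k; exists N.
rewrite -(subnKC Nk); apply: (le_trans (H _)); rewrite subnKC //.
have : C / (x - y) <= k%:R by near: k; apply: nbhs_infty_ger.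
by rewrite ler_pdivrMr /y; lra.
Unshelve. all: by end_near. Qed.

Let act n : option (int * int) :=
  if pselect (exists k, activation_time k = n) is left H
  then Some (p (projT1 (cid H))) else None.

Let act_time k : act (activation_time k) = Some (p k).
Proof.
rewrite /act; case: pselect => [H|[]]; last by exists k.
by case: cid => l /= /time_inj ->.
Qed.

Let act_Some n q : act n = Some q -> exists2 k, activation_time k = n & p k = q.
Proof.
by rewrite /act; case: pselect => // H [<-]; case: cid => k /= kn; exists k.
Qed.

(** The third clause is the point: the delay is negligible with respect to
    the index, so asymptotically [p k] is activated at time [k]. *)
Lemma schedule : exists (v : nat -> option (int * int)) (m : nat -> nat),
  [/\ is_activator_sequence f v,
      (forall n q, v n = Some q -> exists2 k, (k < n)%N & p k = q),
      (forall x : R, 1 < x -> \forall k \near \oo, (m k)%:R <= x * k%:R) &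
      (forall n k q, (m k <= n)%N -> (l1_dist q (p k) <= n - m k)%N ->
         q \in burned f v n)].
Proof.
have actA : is_activator_sequence f act.
  split; last by exists (activation_time 0) => //; rewrite act_time.
  move=> n x n0 /act_Some[k <- <-]; rewrite /grid_vertices in_boxE.
  apply: (leq_trans (p_le_g k)).
  have ek : (g k <= f (entry k))%N.
    by rewrite /entry; case: ex_minnP => m /andP[].
  have e0 : (0 < entry k)%N by rewrite /entry; case: ex_minnP => m /andP[].
  apply: (leq_trans ek).
  by have := @increase_ge f incr_f _ _ e0 (entry_le_time k); lia.
exists act, activation_time; split => //.
- by move=> n q /act_Some[k <- pq]; exists k.
- move=> n k q mn qp; apply/burnedP => //.
  by exists (activation_time k), (p k); rewrite time_gt0 mn act_time.
Qed.

End Scheduling.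

Lemma burned_ge_ball f v n m p : strictly_increasing_pos f ->
  is_activator_sequence f v -> (0 < m <= n)%N -> v m = Some p ->
  (2 * (n - m) ^ 2 <= #|` burned f v n|)%N.
Proof.
move=> incr_f act_v mn vm.
apply: (leq_trans (card_l1_ball_ge p _)).
apply/fsubset_leq_card/fsubsetP => q; rewrite in_l1_ball => qp.
by apply/burnedP => //; exists m, p.
Qed.

(** * Upper bound at order [n^(3/2)] *)

Section ScalingLimits.
Variable R : realType.

Lemma cvg_power (u : nat -> R) (l : R) e :
  u n @[n --> \oo] --> l -> u n ^+ e @[n --> \oo] --> l ^+ e.
Proof. move=> ul; apply: (@continuous_cvg _ _ _ _ _ _ (fun x : R => x ^+ e)) ul.
exact: exprn_continuous. Qed.

Lemma inv_nat_cvg0 : (n%:R^-1 : R) @[n --> \oo] --> 0.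
Proof.
apply: eventually_cvg => l l0; last first.
  by near=> n; apply: (le_trans (ltW l0)); rewrite invr_ge0.
near=> n; have n0 : (0 : R) < n%:R by rewrite ltr0n; near: n; exists 1%N.
rewrite invf_ple ?posrE //; near: n; exact: nbhs_infty_ger.
Unshelve. all: by end_near. Qed.

Lemma inv_sqrt_nat_cvg0 : ((Num.sqrt n%:R)^-1 : R) @[n --> \oo] --> 0.
Proof.
have -> : (fun n => (Num.sqrt n%:R)^-1 : R) = Num.sqrt \o (fun n => n%:R^-1).
  by apply/funext => n /=; rewrite sqrtrV.
rewrite -[X in _ --> X](@sqrtr0 R).
by apply: continuous_cvg; [exact: sqrt_continuous|exact: inv_nat_cvg0].
Qed.

Lemma trunc_cvg_ratio (s : R) : 0 <= s ->
  ((Num.trunc (s * n%:R))%:R / n%:R : R) @[n --> \oo] --> s.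
Proof.
move=> s0; have H (n : nat) := truncn_itv (mulr_ge0 s0 (ler0n R n)).
apply: (@squeeze_cvgr _ _ _ _ (fun n => s - n%:R^-1) (fun=> s)).
- near=> n; have n0 : (0 : R) < n%:R by rewrite ltr0n; near: n; exists 1%N.
  rewrite ler_pdivlMr // ler_pdivrMr // mulrBl mulVf ?gt_eqF //.
  by have /andP[h1 h2] := H n; rewrite -natr1 in h2; apply/andP; split; lra.
- rewrite -[X in _ --> X]subr0; apply: cvgB; first exact: cvg_cst.
  exact: inv_nat_cvg0.
- exact: cvg_cst.
Unshelve. all: by end_near. Qed.

Lemma trunc_cvg_infty (s : R) : 0 < s ->
  Num.trunc (s * n%:R : R) @[n --> \oo] --> \oo.
Proof.
move=> s0; apply/cvgnyPge => A; near=> n.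
rewrite truncn_ge_nat; last by rewrite mulr_ge0 // ltW.
rewrite mulrC -ler_pdivrMr //.
near: n; exact: nbhs_infty_ger.
Unshelve. all: by end_near. Qed.

(** The power [n^(3/2)], as a product for which algebraic identities are
    within reach of field arithmetic. *)
Definition pow32 (n : nat) : R := n%:R * Num.sqrt n%:R.

Lemma pow32_sqr n : pow32 n ^+ 2 = n%:R ^+ 3.
Proof. by rewrite exprMn sqr_sqrtr // -exprSr. Qed.

Lemma pow32_gt0 n : (0 < n)%N -> 0 < pow32 n.
Proof. by move=> n0; rewrite mulr_gt0 ?sqrtr_gt0 ?ltr0n. Qed.

End ScalingLimits.

Arguments pow32 {R} n.

Lemma sum_card_l1_ball I :
  (3 * (\sum_(i < I) (2 * i * i.+1).+1) = 2 * I ^ 3 + I)%N.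
Proof.
elim: I => [|I IH]; first by rewrite big_ord0.
by rewrite big_ord_recr /= mulnDr IH !expnS expn0; nia.
Qed.

(** The activated points stay in boxes of radius [g n], about [a n^(3/2)].
    Taking [g = f] bounds every activator sequence; a smaller [g] bounds
    sequences that use only a part of the grid, down to a single fire
    ([a = 0]). *)
Section UpperBound.
Variables (R : realType) (f : nat -> nat) (v : nat -> option (int * int)).
Hypothesis incr_f : strictly_increasing_pos f.
Hypothesis act_v : is_activator_sequence f v.
Variables (g : nat -> nat) (a : R).
Hypothesis v_le_g : forall m p, (0 < m)%N -> v m = Some p ->
  (sup_norm p <= g m)%N.
Hypothesis g_mono : forall m n, (0 < m)%N -> (m <= n)%N -> (g m <= g n)%N.
Hypothesis a_ge0 : 0 <= a.
Hypothesis g_a : (g n)%:R / pow32 n @[n --> \oo] --> a.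

(** Fires lit up to time [K] stay in one box, where overlaps are
    unavoidable; the later ones are charged the full area of their balls. *)
Lemma card_burned_le K n : (K <= n)%N ->
  (3 * #|` burned f v n| <=
   3 * (2 * (g K + n)).+1 ^ 2 + 2 * (n - K) ^ 3 + (n - K))%N.
Proof.
move=> Kn; rewrite -addnA -sum_card_l1_ball -mulnDr leq_mul2l /=.
pose A i := if i is j.+1 then
   if v (n - j)%N is Some p then l1_ball p j else fset0
  else box (g K + n).
apply: (@leq_trans (\sum_(i < (n - K).+1) #|` A i|)).
  apply: card_cover_le => q /burnedP[] // m [p [mn vm qp]].
  have m0 : (0 < m)%N by case/andP: mn.
  have [mK|Km] := leqP m K.
    exists 0%N => //=; rewrite in_boxE.
    have := sup_norm_dist q p; have := v_le_g _ _ m0 vm.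
    have := g_mono _ _ m0 mK.
    by lia.
  exists (n - m).+1; first by lia.
  have nm : (n - (n - m) = m)%N by lia.
  by rewrite /= nm vm in_l1_ball.
rewrite big_ord_recl /= card_box leq_add2l; apply: leq_sum => i _.
rewrite /=; case: (v _) => [p|]; first by rewrite card_l1_ball.
by rewrite cardfs0.
Qed.

Let w : R := Num.sqrt 6 * a.
(* The minimiser of [4 a^2 s^3 + 2 (1 - s)^3 / 3]. *)
Let s : R := (1 + w)^-1.
Let w_ge0 : 0 <= w. Proof. by rewrite mulr_ge0 ?sqrtr_ge0. Qed.

Lemma burned_eventually_le :
  eventually_le (fun n => #|` burned f v n|%:R / n%:R ^+ 3 : R)
                (4 * a ^+ 2 / (1 + Num.sqrt 6 * a) ^+ 2).
Proof.
have w0 := w_ge0; have s0 : 0 < s by rewrite invr_gt0; lra.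
have s1 : s <= 1 by rewrite /s invf_le1; lra.
pose K n := Num.trunc (s * n%:R : R).
pose k n : R := (K n)%:R / n%:R.
have k_s : k n @[n --> \oo] --> s by apply: trunc_cvg_ratio; exact: ltW.
have K_oo : K n @[n --> \oo] --> \oo by exact: trunc_cvg_infty.
have gK : (g (K n))%:R / pow32 (K n) @[n --> \oo] --> a.
  exact: (cvg_comp _ _ K_oo g_a).
(* [G n] is [g (K n) / n^(3/2)], arranged as a product of convergent
   factors. *)
pose G n : R := (g (K n))%:R / pow32 (K n) * (k n * Num.sqrt (k n)).
have G_lim : G n @[n --> \oo] --> a * (s * Num.sqrt s).
  apply: cvgM => //; apply: cvgM => //.
  by apply: continuous_cvg => //; exact: sqrt_continuous.
pose i n : R := n%:R^-1.
pose W n : R := (2 * (G n + (Num.sqrt n%:R)^-1) + i n * (Num.sqrt n%:R)^-1) ^+ 2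
   + (2 * (1 - k n) ^+ 3 + (1 - k n) * i n ^+ 2) / 3.
apply: (@eventually_le_trans _ _ W).
  near=> n; have n0 : (0 < n)%N by near: n; exists 1%N.
  have n0R : (0 : R) < n%:R by rewrite ltr0n.
  have K0 : (0 < K n)%N by near: n; move/cvgnyPgt: K_oo; apply.
  have Kn : (K n <= n)%N.
    rewrite /K truncn_le_nat -natr1; apply: (@le_lt_trans _ _ n%:R); last by lra.
    by rewrite ler_piMl.
  have sn0 : Num.sqrt n%:R != 0 :> R by rewrite gt_eqF ?sqrtr_gt0.
  have GE : G n = (g (K n))%:R / pow32 n.
    rewrite /G /pow32 /k sqrtrM // sqrtrV //; field.
    by rewrite sn0 !gt_eqF ?ltr0n ?sqrtr_gt0 ?ltr0n.
  have qn : (pow32 n : R) != 0 by rewrite gt_eqF ?pow32_gt0.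
  have -> : W n = ((2 * ((g (K n))%:R + n%:R) + 1) ^+ 2
      + (2 * (n%:R - (K n)%:R) ^+ 3 + (n%:R - (K n)%:R)) / 3) / n%:R ^+ 3.
    rewrite mulrDl; congr (_ + _); last first.
      by rewrite /W /k /i; field; rewrite gt_eqF.
    rewrite -pow32_sqr -expr_div_n; congr (_ ^+ 2).
    by rewrite GE /i /pow32; field; rewrite sn0 gt_eqF.
  rewrite ler_pM2r ?invr_gt0 ?exprn_gt0 //.
  have := card_burned_le _ _ Kn; rewrite -(ler_nat R).
  rewrite -[(2 * _).+1]addn1 !(natrD, natrX, natrM) (natrB _ Kn).
  by set Z := #|` _|%:R; lra.
have -> : 4 * a ^+ 2 / (1 + Num.sqrt 6 * a) ^+ 2 =
    (2 * (a * (s * Num.sqrt s) + 0) + 0 * 0) ^+ 2 +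
    (2 * (1 - s) ^+ 3 + (1 - s) * 0 ^+ 2) / 3.
  have -> : 1 - s = w * s by rewrite /s; field; lra.
  have sE : Num.sqrt s ^+ 2 = s by rewrite sqr_sqrtr ?ltW.
  have wE : w ^+ 2 = 6 * a ^+ 2 by rewrite exprMn sqr_sqrtr.
  have -> : 4 * a ^+ 2 / (1 + Num.sqrt 6 * a) ^+ 2 = 4 * a ^+ 2 * s ^+ 2.
    by rewrite -exprVn.
  have s1E : s * (1 + w) = 1 by rewrite mulVf //; lra.
  have -> : (2 * (a * (s * Num.sqrt s) + 0) + 0 * 0) ^+ 2 =
      4 * a ^+ 2 * s ^+ 3.
    transitivity (4 * a ^+ 2 * s ^+ 2 * Num.sqrt s ^+ 2); first by ring.
    by rewrite sE; ring.
  transitivity (4 * a ^+ 2 * s ^+ 2 * (s * (1 + w))); first by rewrite s1E mulr1.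
  transitivity (4 * a ^+ 2 * s ^+ 3 + (6 * a ^+ 2) * (2 / 3) * w * s ^+ 3).
    by field.
  by rewrite -wE; field.
have i0 : i n @[n --> \oo] --> 0 by exact: inv_nat_cvg0.
have r0 : ((Num.sqrt n%:R)^-1 : R) @[n --> \oo] --> 0 by exact: inv_sqrt_nat_cvg0.
have k1 : 1 - k n @[n --> \oo] --> 1 - s by apply: cvgB => //; exact: cvg_cst.
apply: cvgD.
  apply: cvg_power; apply: cvgD; last exact: cvgM.
  by apply: cvgM; [exact: cvg_cst|exact: cvgD].
apply: cvgM; last exact: cvg_cst.
apply: cvgD; first by apply: cvgM; [exact: cvg_cst|exact: cvg_power].
by apply: cvgM => //; exact: cvg_power.
Unshelve. all: by end_near. Qed.

End UpperBound.

(** * Lower bound from a packing of diamonds *)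

Lemma sum_squares_ge M : (M ^ 3 <= 3 * \sum_(i < M.+1) i ^ 2)%N.
Proof.
elim: M => [|M IH] //; rewrite big_ord_recr /= mulnDr.
by move: (\sum_(i < M.+1) _)%N IH => S; rewrite !expnS !expn0; nia.
Qed.

Lemma sum_rev_squares_ge M : (M ^ 3 <= 3 * \sum_(i < M) (M - i) ^ 2)%N.
Proof.
elim: M => [|M IH] //; rewrite big_ord_recl /= mulnDr subn0.
under eq_bigr => i _ do rewrite /bump add1n subSS.
by move: (\sum_(i < M) _)%N IH => S; rewrite !expnS !expn0; nia.
Qed.

(** Points [p k] lit at times [m k], about [k], and surrounded by disjoint balls
    of radius [r k], about [b k]: only the part of each fire that stays in
    its own ball is counted. *)
Section LowerBound.
Variables (R : realType) (f : nat -> nat) (v : nat -> option (int * int)).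
Variables (p : nat -> int * int) (m r : nat -> nat) (b : R).
Hypothesis b_gt0 : 0 < b.
Hypothesis burned_m : forall n k q, (m k <= n)%N ->
  (l1_dist q (p k) <= n - m k)%N -> q \in burned f v n.
Hypothesis m_le : forall x : R, 1 < x ->
  \forall k \near \oo, (m k)%:R <= x * k%:R.
Hypothesis r_ge : forall x : R, 1 < x ->
  \forall k \near \oo, b / x * k%:R <= (r k)%:R.
Hypothesis r_disjoint : exists k0, forall k l q, (k0 <= k < l)%N ->
  (l1_dist q (p k) <= r k)%N -> (l1_dist q (p l) <= r l)%N -> False.

Let X n : R := #|` burned f v n|%:R / n%:R ^+ 3.

(** The asymptotic hypotheses are used with a fixed slack [x > 1], which is sent
    to [1] at the end. *)
Section FixedSlack.
Variable x : R.
Hypothesis x_gt1 : 1 < x.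

(* Up to index [K1 n] the radius [b k / x] of the private ball is the smaller
   one; from there to [K2 n] it is the age [n - x k] of the fire. *)
Let K1 n := Num.trunc ((x + b / x)^-1 * n%:R).
Let K2 n := Num.trunc (x^-1 * n%:R).
Let x_gt0 : 0 < x. Proof. exact: lt_trans x_gt1. Qed.
Let bx_gt0 : 0 < b / x. Proof. exact: divr_gt0. Qed.

(** The two terms are the sums of the areas over the two ranges of indices,
    each bounded by the corresponding integral; the terms with [N] and [- 1]
    account for the first indices and for rounding. *)
Lemma card_burned_ge : exists N : nat, \forall n \near \oo,
  2 * (b / x) ^+ 2 * ((K1 n)%:R ^+ 3 / 3 - ((K1 n)%:R + 1) * N%:R ^+ 2)
  + 2 * x ^+ 2 * ((K2 n)%:R - (K1 n)%:R - 1) ^+ 3 / 3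
  <= #|` burned f v n|%:R.
Proof.
have x0 := x_gt0; have bx0 := bx_gt0; have b0 := b_gt0.
have [k0 dis] := r_disjoint.
have [Nm _ mN] := m_le x x_gt1; have [Nr _ rN] := r_ge x x_gt1.
exists (maxn k0 (maxn Nm Nr)); set N := maxn _ _.
have NP i : (N <= i)%N -> [/\ (k0 <= i)%N, (Nm <= i)%N & (Nr <= i)%N].
  by rewrite !geq_max => /and3P.
have y0 : 0 < (x + b / x)^-1 by rewrite invr_gt0; lra.
near=> n; have NK : (N <= K1 n)%N.
  by near: n; move/cvgnyPge: (trunc_cvg_infty R _ y0); apply.
have K1n : (K1 n)%:R * (x + b / x) <= n%:R.
  rewrite -ler_pdivlMr 1?mulrC; last by lra.
  by rewrite truncn_le mulr_ge0 // ltW.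
have K1n' : n%:R < (K1 n).+1%:R * (x + b / x).
  by rewrite -ltr_pdivrMr 1?mulrC; [exact: truncnS_gt|lra].
have K2n : (K2 n)%:R * x <= n%:R.
  by rewrite -ler_pdivlMr // mulrC truncn_le mulr_ge0 // invr_ge0 ltW.
have K2n' : n%:R < (K2 n).+1%:R * x.
  by rewrite -ltr_pdivrMr // mulrC; exact: truncnS_gt.
have K12 : (K1 n < K2 n)%N.
  rewrite truncn_ge_nat ?mulr_ge0 ?invr_ge0 ?(ltW x0) // -natr1.
  have : (x^-1 - (x + b / x)^-1)^-1 <= n%:R by near: n; exact: nbhs_infty_ger.
  have d0 : 0 < x^-1 - (x + b / x)^-1.
    by rewrite subr_gt0 ltf_pV2 ?posrE //; lra.
  rewrite -div1r ler_pdivrMr // mulrBr.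
  have : (K1 n)%:R <= n%:R * (x + b / x)^-1 by rewrite ler_pdivlMr //; lra.
  by rewrite (mulrC x^-1); lra.
pose A i := if (N <= i)%N && (m i <= n)%N
  then l1_ball (p i) (minn (n - m i) (r i)) else fset0.
have AB : (\sum_(i < K2 n) #|` A i| <= #|` burned f v n|)%N.
  apply: card_packing_ge => [i _|i j q ijn].
    apply/fsubsetP => q; rewrite /A; case: andP => [[Ni mi]|_].
      by rewrite in_l1_ball leq_min => /andP[qp _]; apply: burned_m qp.
    by rewrite in_fset0.
  rewrite /A; case: andP => [[Ni mi]|_]; last by rewrite in_fset0.
  case: andP => [[Nj mj]|_]; last by rewrite in_fset0.
  rewrite !in_l1_ball !leq_min => /andP[_ h1] /andP[_ h2].
  by have [k0i _ _] := NP i Ni; apply: (dis i j q) => //; case/andP: ijn => -> _; rewrite k0i.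
have Age i (y : R) : (N <= i)%N -> 0 <= y -> y <= n%:R - x * i%:R ->
    y <= b / x * i%:R -> 2 * y ^+ 2 <= #|` A i|%:R.
  move=> Ni yge0 y1 y2.
  have [_ Nmi Nri] := NP i Ni.
  have mi : (m i)%:R <= x * i%:R by exact: mN.
  have ri : b / x * i%:R <= (r i)%:R by exact: rN.
  have min_ : (m i <= n)%N.
    by rewrite -(ler_nat R) (le_trans mi) // -subr_ge0 (le_trans yge0).
  rewrite /A Ni min_ /=; set t := minn _ _; have yt : y <= t%:R.
    rewrite /t /minn; case: ifP => _; last exact: (le_trans y2).
    by rewrite natrB // (le_trans y1) // lerD2l lerN2.
  apply: (@le_trans _ _ (2 * t%:R ^+ 2)).
    by rewrite ler_pM2l // ler_pXn2r // nnegrE.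
  by rewrite -natrX -natrM ler_nat card_l1_ball_ge.
apply: (@le_trans _ _ (\sum_(i < K2 n) #|` A i|)%:R); last by rewrite ler_nat.
(* Reindexed from the end, the ages in the second range dominate the
   multiples of [x]. *)
have K2E := subnKC K12; set J := (K2 n - (K1 n).+1)%N in K2E.
have -> : (K2 n)%:R - (K1 n)%:R - 1 = J%:R :> R.
  by rewrite -K2E natrD -natr1; ring.
rewrite -K2E big_split_ord /= natrD; apply: lerD.
- rewrite natr_sum.
  (* The indices below [N], for which nothing is known, are absorbed by
     subtracting a constant from every term. *)
  apply: (@le_trans _ _ (\sum_(i < (K1 n).+1)
      (2 * (b / x) ^+ 2 * (i%:R ^+ 2 - N%:R ^+ 2)))).
    rewrite -mulr_sumr ler_pM2l; last by rewrite mulr_gt0 // exprn_gt0.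
    rewrite big_split /= sumr_const card_ord -[_ *+ (K1 n).+1]mulr_natl.
    rewrite lerD //; last by rewrite mulrN lerN2 natr1.
    have := sum_squares_ge (K1 n); rewrite -(ler_nat R) natrM natrX natr_sum.
    under eq_bigr => i _ do rewrite natrX.
    by lra.
  apply: ler_sum => i _; have [Ni|iN] := leqP N i; last first.
    apply: (@le_trans _ _ 0); last exact: ler0n.
    rewrite pmulr_rle0; last by rewrite mulr_gt0 // exprn_gt0.
    by rewrite subr_le0 ler_pXn2r ?nnegrE // ler_nat ltnW.
  apply: (@le_trans _ _ (2 * (b / x * i%:R) ^+ 2)).
    rewrite [(b / x * _) ^+ 2]exprMn [leRHS]mulrA ler_pM2l.
      by rewrite gerBl exprn_ge0.
    by rewrite mulr_gt0 // exprn_gt0.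
  apply: Age => //; first by rewrite mulr_ge0 // ltW.
  rewrite lerBrDl -mulrDl; apply: le_trans K1n; rewrite mulrC.
  by rewrite ler_pM2r; [rewrite ler_nat -ltnS|lra].
- rewrite natr_sum.
  apply: (@le_trans _ _ (\sum_(i < J) (2 * x ^+ 2 * (J - i)%:R ^+ 2))).
    rewrite -mulr_sumr -mulrA ler_pM2l; last by rewrite mulr_gt0 // exprn_gt0.
    have := sum_rev_squares_ge J; rewrite -(ler_nat R) natrM natrX natr_sum.
    under eq_bigr => i _ do rewrite natrX.
    by rewrite ler_pdivrMr // mulrC.
  apply: ler_sum => i _; rewrite -mulrA -exprMn.
  have iJ := ltn_ord i.
  have e : x * (J - i)%:R = x * (K2 n)%:R - x * ((K1 n).+1 + i)%:R.
    by rewrite -mulrBr /J -subnDA natrB // -leq_subRL // ltnW.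
  apply: Age; first by rewrite (leq_trans NK) // addSnnS leq_addr.
  + by rewrite mulr_ge0 // ltW.
  + by rewrite e lerD2r mulrC.
  + rewrite e lerBlDr -mulrDl (mulrC x); apply: (le_trans K2n).
    apply/ltW/(lt_le_trans K1n'); rewrite mulrC addrC ler_pM2l; last by lra.
    by rewrite ler_nat leq_addr.
Unshelve. all: by end_near. Qed.

Lemma slack_eventually_ge :
  eventually_ge X (2 / 3 * b ^+ 2 / (x * (x ^+ 2 + b) ^+ 2)).
Proof.
have x0 := x_gt0; have b0 := b_gt0; have bx0 := bx_gt0.
have [N card_ge] := card_burned_ge.
pose i n : R := n%:R^-1.
pose k1 n : R := (K1 n)%:R / n%:R; pose k2 n : R := (K2 n)%:R / n%:R.
pose W n : R := 2 * (b / x) ^+ 2 *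
    (k1 n ^+ 3 / 3 - (k1 n + i n) * (N%:R * i n) ^+ 2)
  + 2 * x ^+ 2 * (k2 n - k1 n - i n) ^+ 3 / 3.
apply: (@eventually_ge_trans _ _ W).
  apply: filterS2 card_ge (nbhs_infty_gt 0) => n card_ge_n n_gt0.
  have n0 : (0 : R) < n%:R by rewrite ltr0n.
  rewrite /X ler_pdivlMr ?exprn_gt0 //; apply: le_trans card_ge_n.
  rewrite le_eqVlt; apply/orP; left; apply/eqP.
  by rewrite /W /k1 /k2 /i; field; rewrite !gt_eqF.
have i0 : i n @[n --> \oo] --> 0 by exact: inv_nat_cvg0.
pose z1 : R := (x + b / x)^-1; pose z2 : R := x^-1.
have k1z : k1 n @[n --> \oo] --> z1.
  by apply: trunc_cvg_ratio; rewrite invr_ge0 ltW // addr_gt0.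
have k2z : k2 n @[n --> \oo] --> z2.
  by apply: trunc_cvg_ratio; rewrite invr_ge0 ltW.
have -> : 2 / 3 * b ^+ 2 / (x * (x ^+ 2 + b) ^+ 2) =
    2 * (b / x) ^+ 2 * (z1 ^+ 3 / 3 - (z1 + 0) * (N%:R * 0) ^+ 2)
    + 2 * x ^+ 2 * (z2 - z1 - 0) ^+ 3 / 3.
  have xb : x ^+ 2 + b != 0 by rewrite gt_eqF // addr_gt0 // exprn_gt0.
  have z1E : z1 = x / (x ^+ 2 + b).
    rewrite /z1; have -> : x + b / x = (x ^+ 2 + b) / x.
      by field; rewrite gt_eqF.
    by rewrite invf_div.
  rewrite z1E /z2; field.
  by rewrite xb gt_eqF.
have N0 : N%:R * i n @[n --> \oo] --> (N%:R * 0 : R).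
  by apply: cvgM => //; exact: cvg_cst.
apply: cvgD.
  apply: cvgM; first exact: cvg_cst.
  apply: cvgB; first by apply: cvgM; [exact: cvg_power|exact: cvg_cst].
  by apply: cvgM; [exact: cvgD|exact: cvg_power].
apply: cvgM; last exact: cvg_cst.
apply: cvgM; first exact: cvg_cst.
by apply: cvg_power; apply: cvgB => //; exact: cvgB.
Qed.

End FixedSlack.

Lemma burned_eventually_ge : eventually_ge X (2 / 3 * b ^+ 2 / (1 + b) ^+ 2).
Proof.
move=> l ll; pose x k : R := 1 + k%:R^-1.
have xcvg : x k @[k --> \oo] --> (1 + 0 : R).
  by apply: cvgD; [exact: cvg_cst|exact: inv_nat_cvg0].
have Lcvg : 2 / 3 * b ^+ 2 / (x k * (x k ^+ 2 + b) ^+ 2) @[k --> \oo] -->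
    (2 / 3 * b ^+ 2 / ((1 + 0) * ((1 + 0) ^+ 2 + b) ^+ 2) : R).
  apply: cvgM; first exact: cvg_cst.
  have b0 := b_gt0; apply: cvgV.
    by rewrite addr0 mul1r expr1n expf_neq0 // gt_eqF //; lra.
  apply: cvgM => //; apply: cvg_power; apply: cvgD; last exact: cvg_cst.
  exact: cvg_power.
rewrite addr0 mul1r expr1n in Lcvg.
have [k _ kP] := cvgr_gt _ Lcvg _ ll.
apply: (slack_eventually_ge (x k.+1)) (kP k.+1 (leqnSn k)).
by rewrite /x ltrDl invr_gt0 ltr0n.
Qed.

End LowerBound.

(** * Blocks of indices, and an asymptotically perfect packing *)

(** The hypothesis of the scheduling lemma for sequences of the same order of
    growth [h]: if [a <= c] then a delay by a factor [x > 1] makes up for the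
    fluctuations of [f] and [g], even when [a = c]. *)
Lemma eventually_le_shift (R : realType) (h : nat -> R) (f g : nat -> nat) (a c : R) :
  0 < c -> a <= c ->
  (forall n, (0 < n)%N -> 0 < h n) ->
  (forall x k m, 1 < x -> x * k%:R <= m%:R -> x * h k <= h m) ->
  (g n)%:R / h n @[n --> \oo] --> a -> (f n)%:R / h n @[n --> \oo] --> c ->
  forall x : R, 1 < x ->
    \forall k \near \oo, forall m, x * k%:R <= m%:R -> (g k <= f m)%N.
Proof.
move=> c0 ac h0 hx ga fc x x1.
pose l := c * (2 / (1 + x)).
have q1 : 2 / (1 + x) < 1 by rewrite ltr_pdivrMr; lra.
have lc : l < c by rewrite /l gtr_pMr.
have al : a < x * l.
  apply: (le_lt_trans ac); rewrite /l mulrCA ltr_pMr // mulrA ltr_pdivlMr; lra.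
have [N _ fN] := cvg_eventually_ge _ _ _ fc _ lc.
near=> k => m km.
have k0 : (0 < k)%N by near: k; exact: nbhs_infty_gt.
have Nk : (N <= k)%N by near: k; exists N.
have km' : (k <= m)%N.
  by rewrite -(ler_nat R); apply: le_trans km; rewrite ler_peMl // ltW.
have gk : (g k)%:R / h k <= x * l.
  by near: k; exact: cvg_eventually_le _ _ _ ga _ al.
have fm : l <= (f m)%:R / h m by apply: fN; exact: leq_trans km'.
rewrite ler_pdivrMr ?h0 // in gk.
rewrite ler_pdivlMr ?h0 ?(leq_trans k0) // in fm.
rewrite -(ler_nat R) (le_trans gk) // (le_trans _ fm) // -mulrA mulrCA.
rewrite ler_pM2l ?hx // /l mulr_gt0 // divr_gt0 //; lra.
Unshelve. all: by end_near. Qed.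

Section Blocks.

Lemma leq_exp4 n : (n <= n ^ 4)%N.
Proof. by case: n => // n; rewrite -{1}(expn1 n.+1) leq_pexp2l. Qed.

(** The length of a block, of order [j^3], is negligible against its position,
    so all its points may be treated as simultaneous, but large against
    the square root [j^2] of that position, so it has room for a good
    two-dimensional lattice.  The factor [6] makes the parameters of the
    packing below integral. *)
Definition block_start (j : nat) : nat := (6 * j ^ 4)%N.

Definition block (k : nat) : nat := \max_(j < k.+1 | (block_start j <= k)%N) j.

Lemma block_start_mono : {homo block_start : i j / (i <= j)%N}.
Proof. by move=> i j ij; rewrite leq_mul2l /= leq_exp2r. Qed.

Lemma block_bounds k : (block_start (block k) <= k < block_start (block k).+1)%N.
Proof.
apply/andP; split.
  rewrite /block; elim/big_ind : _ => // x y hx hy.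
  by rewrite /maxn; case: ifP.
rewrite ltnNge; apply/negP => h.
have bk : ((block k).+1 < k.+1)%N.
  by rewrite ltnS; apply: leq_trans h; have := leq_exp4 (block k).+1; rewrite /block_start; lia.
by have := @leq_bigmax_cond _ (fun j : 'I_k.+1 => (block_start j <= k)%N)
  (fun j : 'I_k.+1 => j : nat) (Ordinal bk) h; rewrite /= ltnn.
Qed.

Lemma block_mono : {homo block : k l / (k <= l)%N}.
Proof.
move=> k l kl; rewrite leqNgt; apply/negP => lk.
have /andP[_ h1] := block_bounds l; have /andP[h2 _] := block_bounds k.
by have := block_start_mono _ _ lk; lia.
Qed.

Lemma blockE j k : (block_start j <= k < block_start j.+1)%N -> block k = j.
Proof.
move=> /andP[jk kj]; have /andP[h1 h2] := block_bounds k.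
apply/eqP; rewrite eqn_leq; apply/andP; split; rewrite leqNgt; apply/negP => h.
  by have := block_start_mono _ _ h; lia.
by have := block_start_mono _ _ h; lia.
Qed.

Lemma block_cvg_infty : block k @[k --> \oo] --> \oo.
Proof.
apply/cvgnyPge => A; exists (block_start A) => // k /= Ak.
by have := block_mono _ _ Ak; rewrite (@blockE A) // leqnn /block_start !expnS; nia.
Qed.

(** Blocks that are too short for [S j] drop its last points; those that are too
    long repeat the origin, a point of every region considered below. *)
Definition in_blocks (S : nat -> seq (int * int)) (k : nat) : int * int :=
  nth (0, 0) (S (block k)) (k - block_start (block k)).

Lemma block_ratio (R : realType) :
  ((block_start (block k))%:R / k%:R : R) @[k --> \oo] --> (1 : R).
Proof.
apply: (@squeeze_cvgr _ _ _ _
  (fun k => ((1 + (block k)%:R^-1) ^- 4)) (fun=> 1)); last exact: cvg_cst.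
- near=> k; have k0 : (0 : R) < k%:R.
    by rewrite ltr0n; near: k; exact: nbhs_infty_gt.
  have b0 : (0 : R) < (block k)%:R.
    by rewrite ltr0n; near: k; move/cvgnyPgt: block_cvg_infty; apply.
  have /andP[h1 h2] := block_bounds k; apply/andP; split; last first.
    by rewrite ler_pdivrMr // mul1r ler_nat.
  move: h2; rewrite /block_start -(ltr_nat R) !(natrX, natrM) -[(block k).+1%:R]natr1 => h2.
  rewrite ler_pdivlMr // mulrC ler_pdivrMr; last by rewrite exprn_gt0 // addr_gt0 // invr_gt0.
  apply: (le_trans (ltW h2)).
  by rewrite -mulrA -exprMn mulrDr mulr1 mulfV ?gt_eqF.
- have e1 : (1 + 0) ^- 4 = 1 :> R by rewrite addr0 expr1n invr1.
  rewrite -[X in _ --> X]e1.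
  apply: cvgV; first by rewrite addr0 expr1n oner_neq0.
  apply: cvg_power; apply: cvgD; first exact: cvg_cst.
  exact: (cvg_comp _ _ block_cvg_infty (inv_nat_cvg0 R)).
Unshelve. all: by end_near. Qed.

End Blocks.

(** Block [j] is placed in a square annulus, filled with a lattice of diamonds
    of radius about [6 sqrt 6 a j^4], that is [sqrt 6 a] times the index.  In
    units of the radius the annulus extends from [j^2 + 3] to [(j + 3)^2]: it
    is wide enough to hold the [24 j^3 + O(j^2)] points of the block, and starts
    outside the previous annulus.  Its outer radius is about
    [6 sqrt 6 a j^6], which is [a (6 j^4)^(3/2)]. *)
Section Packing.
Variables (R : realType) (a : R).
Hypothesis a_gt0 : 0 < a.

Let beta : R := 6 * Num.sqrt 6 * a.
Let beta_gt0 : 0 < beta.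
Proof. by rewrite !mulr_gt0 ?sqrtr_gt0. Qed.

Definition cell_radius (j : nat) : nat := Num.trunc (beta * (j ^ 4)%:R).
Definition ring_inner (j : nat) : nat := (j ^ 2 + 3)%N.
Definition ring_outer (j : nat) : nat := ((j + 3) ^ 2)%N.

Definition annulus (j : nat) : {fset int * int} :=
  (l1_ball 0 (ring_outer j) `\` l1_ball 0 (ring_inner j))%fset.

(** The rotation by 45 degrees turns the l1-norm of the index into the sup-norm
    of the centre, and makes the lattice one for which diamonds of radius
    [r] tile the plane. *)
Definition seed (r : nat) (w : int * int) : int * int :=
  (r%:Z * (w.1 + w.2), r%:Z * (w.1 - w.2)).

Definition packing : nat -> int * int :=
  in_blocks (fun j => [seq seed (cell_radius j) w | w <- annulus j]).

Definition packing_radius (k : nat) : nat := (cell_radius (block k)).-1.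
Definition packing_extent (k : nat) : nat :=
  (cell_radius (block k) * ring_outer (block k))%N.

Lemma sup_norm_seed r w : sup_norm (seed r w) = (r * l1_norm w)%N.
Proof.
rewrite /sup_norm /l1_norm /seed /= !abszM absz_nat -maxnMr; congr (_ * _)%N.
by lia.
Qed.

Lemma l1_dist_seed r w w' : w != w' ->
  (2 * r <= l1_dist (seed r w) (seed r w'))%N.
Proof.
case: w w' => [s t] [s' t'] neq; rewrite /l1_dist /l1_norm /seed /=.
rewrite -!mulrBr !abszM absz_nat -mulnDr mulnC leq_mul2l; apply/orP; right.
have {}neq : (s != s') || (t != t').
  by move: neq; rewrite xpair_eqE negb_and.
by lia.
Qed.

Lemma in_annulus j w : (w \in annulus j) = (ring_inner j < l1_norm w <= ring_outer j)%N.
Proof. by rewrite in_fsetD !in_l1_ball /l1_dist subr0 -ltnNge. Qed.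

Lemma card_annulus_ge j :
  (block_start j.+1 - block_start j <= #|` annulus j|)%N.
Proof.
have sub : (l1_ball 0 (ring_inner j) `<=` l1_ball 0 (ring_outer j))%fset.
  apply/fsubsetP => q; rewrite !in_l1_ball => /leq_trans; apply.
  by rewrite /ring_inner /ring_outer; nia.
rewrite cardfsDS // !card_l1_ball /block_start /ring_inner /ring_outer.
rewrite leq_subLR addnBA; last by rewrite !expnS !expn0; nia.
by rewrite leq_subRL !expnS !expn0; nia.
Qed.

Lemma packing_in_annulus k : exists2 w, w \in annulus (block k) &
  packing k = seed (cell_radius (block k)) w.
Proof.
have /andP[h1 h2] := block_bounds k; have h3 := card_annulus_ge (block k).
have lt : (k - block_start (block k) < size (annulus (block k)))%N by lia.
exists (nth (0, 0) (annulus (block k)) (k - block_start (block k))).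
  exact: mem_nth.
by rewrite /packing /in_blocks (nth_map (0, 0)).
Qed.

Lemma packing_separated k l : block k = block l -> k != l ->
  (2 * cell_radius (block k) <= l1_dist (packing k) (packing l))%N.
Proof.
move=> kl nkl.
have /andP[k1 k2] := block_bounds k; have /andP[l1 l2] := block_bounds l.
have h3 := card_annulus_ge (block k).
have ltk : (k - block_start (block k) < size (annulus (block k)))%N by lia.
have ltl : (l - block_start (block l) < size (annulus (block l)))%N.
  by rewrite -kl in l1 l2 *; lia.
rewrite /packing /in_blocks !(nth_map (0, 0)) // -kl.
apply: l1_dist_seed; rewrite nth_uniq ?fset_uniq //; last by rewrite kl.
by rewrite -kl in l1 l2; lia.
Qed.

Lemma cell_radius_mono : {homo cell_radius : i j / (i <= j)%N}.
Proof.
move=> i j ij; apply: le_truncn.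
by rewrite ler_wpM2l ?(ltW beta_gt0) // ler_nat leq_exp2r.
Qed.

(** The quartic growth of the cell radius leaves room of relative order
    [1 / j^2] between consecutive annuli, which beats the rounding error as
    soon as [beta * j >= 1]. *)
Lemma annuli_nested : exists j0, forall j j', (j0 <= j < j')%N ->
  (0 < cell_radius j)%N /\
  (cell_radius j * (ring_outer j).+1 <= cell_radius j' * ring_inner j')%N.
Proof.
have b0 := beta_gt0; pose j0 := (Num.trunc beta^-1).+1.
have jP j : (j0 <= j)%N -> 1 <= beta * j%:R.
  move=> hj; rewrite -ler_pdivrMl // mulr1.
  apply: (le_trans (ltW (truncnS_gt _))).
  by rewrite ler_nat.
have step j : (j0 <= j)%N -> (cell_radius j * (ring_outer j).+1 <=
    cell_radius j.+1 * ring_inner j.+1)%N.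
  move=> hj; have bj := jP j hj.
  have j1 : 1 <= j%:R :> R by rewrite ler1n; apply: leq_trans hj.
  have r1 : (cell_radius j)%:R <= beta * (j ^ 4)%:R.
    by rewrite truncn_le mulr_ge0 // ltW.
  have r2 : beta * (j.+1 ^ 4)%:R <= (cell_radius j.+1)%:R + 1.
    by rewrite natr1; apply/ltW/truncnS_gt.
  rewrite -(ler_nat R) /ring_outer /ring_inner.
  rewrite -[(_ ^ 2).+1]addn1 !(natrX, natrM, natrD) -[j.+1%:R]natr1.
  move: r1 r2; rewrite !natrX -[j.+1%:R]natr1.
  move: (cell_radius j)%:R (cell_radius j.+1)%:R => r r'.
  set t : R := j%:R in bj j1 *; move=> r1 r2.
  apply: (@le_trans _ _ (beta * t ^+ 4 * ((t + 3) ^+ 2 + 1))).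
    by rewrite ler_wpM2r // addr_ge0 // sqr_ge0.
  apply: (@le_trans _ _ ((beta * (t + 1) ^+ 4 - 1) * ((t + 1) ^+ 2 + 3))); last first.
    by rewrite ler_wpM2r //; [rewrite addr_ge0 // sqr_ge0|lra].
  rewrite -subr_ge0.
  have -> : (beta * (t + 1) ^+ 4 - 1) * ((t + 1) ^+ 2 + 3) -
     beta * t ^+ 4 * ((t + 3) ^+ 2 + 1) =
     (beta * t) * (8 * t ^+ 3 + 32 * t ^+ 2 + 33 * t + 18) + 4 * beta
     - (t ^+ 2 + 2 * t + 4) by ring.
  have t2 : 1 <= t ^+ 2 by rewrite exprn_ege1.
  have t3 : t ^+ 2 <= t ^+ 3 by rewrite ler_weXn2l.
  have : 1 * (8 * t ^+ 3 + 32 * t ^+ 2 + 33 * t + 18) <=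
     (beta * t) * (8 * t ^+ 3 + 32 * t ^+ 2 + 33 * t + 18).
    by rewrite ler_wpM2r //; lra.
  by lra.
exists j0 => j j' /andP[hj jj'].
split.
  rewrite /cell_radius truncn_gt0 (le_trans (jP j hj)) //.
  by rewrite ler_pM2l // ler_nat leq_exp4.
elim: j' jj' => [|j' IH] //; rewrite ltnS leq_eqVlt => /predU1P[<-|jj'].
  exact: step.
apply: (leq_trans (IH jj')); apply: leq_trans (step j' _); last by lia.
by rewrite leq_mul2l; apply/orP; right; rewrite /ring_inner /ring_outer; nia.
Qed.

(** Within a block, the centres are too far apart; in different blocks,
    the balls are separated by their sup-norms. *)
Lemma packing_disjoint : exists k0, forall k l q, (k0 <= k < l)%N ->
  (l1_dist q (packing k) <= packing_radius k)%N ->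
  (l1_dist q (packing l) <= packing_radius l)%N -> False.
Proof.
have [j0 nested] := annuli_nested.
exists (block_start j0) => k l q /andP[jk kl] qk ql.
have j0k : (j0 <= block k)%N.
  rewrite leqNgt; apply/negP => h; have /andP[_ h2] := block_bounds k.
  by have := block_start_mono _ _ h; lia.
have [r0 _] := nested (block k) (block k).+1 ltac:(lia).
rewrite /packing_radius in qk ql.
have := block_mono _ _ (ltnW kl); rewrite leq_eqVlt => /predU1P[bkl|bkl].
  have := packing_separated k l bkl ltac:(lia).
  have := l1_dist_triangle (packing k) q (packing l).
  by rewrite (l1_distC (packing k) q); rewrite -bkl in ql; lia.
have [_ sep] := nested _ _ (introT andP (conj j0k bkl)).
have [w wr wE] := packing_in_annulus k; have [z zr zE] := packing_in_annulus l.
rewrite in_annulus in wr; rewrite in_annulus in zr.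
have := sup_norm_dist q (packing k); have := sup_norm_dist (packing l) q.
rewrite (l1_distC _ q) wE zE !sup_norm_seed -wE -zE.
have {zr} : (cell_radius (block l) * (ring_inner (block l)).+1 <=
   cell_radius (block l) * l1_norm z)%N.
  by rewrite leq_mul2l; case/andP: zr => -> _; rewrite orbT.
have {wr} : (cell_radius (block k) * l1_norm w <=
   cell_radius (block k) * ring_outer (block k))%N.
  by rewrite leq_mul2l; case/andP: wr => _ ->; rewrite orbT.
move: sep; rewrite !mulnS.
have : (cell_radius (block k) <= cell_radius (block l))%N.
  by apply: cell_radius_mono; apply: ltnW.
by lia.
Qed.

Lemma packing_le_extent k : (sup_norm (packing k) <= packing_extent k)%N.
Proof.
have [w wr ->] := packing_in_annulus k; rewrite sup_norm_seed leq_mul2l.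
by move: wr; rewrite in_annulus => /andP[_ ->]; rewrite orbT.
Qed.

Lemma packing_extent_mono : {homo packing_extent : k l / (k <= l)%N}.
Proof.
move=> k l /block_mono kl; apply: leq_mul; first exact: cell_radius_mono.
by rewrite /ring_outer leq_exp2r // leq_add2r.
Qed.

Let cell_ratio : (cell_radius (block k))%:R / (block k ^ 4)%:R
  @[k --> \oo] --> beta.
Proof.
have b4 : (block k ^ 4)%N @[k --> \oo] --> \oo.
  apply/cvgnyPge => A; move/cvgnyPge: block_cvg_infty => /(_ A).
  by apply: filterS => k Ak; apply: (leq_trans Ak); exact: leq_exp4.
exact: (cvg_comp _ _ b4 (trunc_cvg_ratio R beta (ltW beta_gt0))).
Qed.

Lemma packing_radius_ge x : 1 < x ->
  \forall k \near \oo, (Num.sqrt 6 * a) / x * k%:R <= (packing_radius k)%:R.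
Proof.
move=> x1; have b0 : 0 < Num.sqrt 6 * a by rewrite mulr_gt0 // sqrtr_gt0.
pose u k : R := (cell_radius (block k))%:R / (block k ^ 4)%:R *
   ((block_start (block k))%:R / k%:R / 6) - k%:R^-1.
have uE : u k @[k --> \oo] --> (beta * (1 / 6) - 0 : R).
  apply: cvgB; last exact: inv_nat_cvg0.
  apply: cvgM => //; apply: cvgM; first exact: block_ratio.
  exact: cvg_cst.
have {}uE : u k @[k --> \oo] --> (Num.sqrt 6 * a : R).
  by move: uE; rewrite subr0 /beta; congr (_ --> _); field.
near=> k; have k0 : (0 : R) < k%:R.
  by rewrite ltr0n; near: k; exact: nbhs_infty_gt.
have b4 : (0 : R) < (block k)%:R.
  by rewrite ltr0n; near: k; move/cvgnyPgt: block_cvg_infty; apply.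
rewrite -ler_pdivlMr //; apply: (@le_trans _ _ (u k)).
  near: k; apply: (cvg_eventually_ge _ _ _ uE).
  by rewrite ltr_pdivrMr ?ltr_pMr // (lt_trans _ x1).
have -> : u k = ((cell_radius (block k))%:R - 1) / k%:R.
  rewrite /u /block_start natrM natrX; field.
  by rewrite !gt_eqF.
rewrite ler_pM2r ?invr_gt0 // /packing_radius lerBlDr natr1 ler_nat.
by case: (cell_radius _).
Unshelve. all: by end_near. Qed.

(** The identity behind it is [(6 sqrt 6 a j^4) j^2 = a (6 j^4)^(3/2)]. *)
Lemma packing_extent_ratio :
  (packing_extent k)%:R / pow32 k @[k --> \oo] --> a.
Proof.
pose t k : R := (block_start (block k))%:R / k%:R.
have tcvg : t k @[k --> \oo] --> (1 : R) by exact: block_ratio.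
pose i k : R := (block k)%:R^-1.
have icvg : i k @[k --> \oo] --> 0.
  exact: (cvg_comp _ _ block_cvg_infty (inv_nat_cvg0 R)).
pose u k : R := (cell_radius (block k))%:R / (block k ^ 4)%:R *
  (1 + 3 * i k) ^+ 2 * (t k * Num.sqrt (t k) / (6 * Num.sqrt 6)).
have s6 : 0 < Num.sqrt 6 :> R by rewrite sqrtr_gt0.
have ucvg : u k @[k --> \oo] -->
    (beta * (1 + 3 * 0) ^+ 2 * (1 * Num.sqrt 1 / (6 * Num.sqrt 6)) : R).
  apply: cvgM.
    apply: cvgM => //; apply: cvg_power; apply: cvgD; first exact: cvg_cst.
    by apply: cvgM => //; exact: cvg_cst.
  apply: cvgM; last exact: cvg_cst.
  apply: cvgM => //; apply: continuous_cvg => //; exact: sqrt_continuous.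
have <- : beta * (1 + 3 * 0) ^+ 2 * (1 * Num.sqrt 1 / (6 * Num.sqrt 6)) = a.
  by rewrite sqrtr1 /beta; field; rewrite gt_eqF.
apply: cvg_trans ucvg; apply: near_eq_cvg; near=> k.
have k0 : (0 : R) < k%:R by rewrite ltr0n; near: k; exact: nbhs_infty_gt.
have b4 : (0 : R) < (block k)%:R.
  by rewrite ltr0n; near: k; move/cvgnyPgt: block_cvg_infty; apply.
have tE : t k * Num.sqrt (t k) / (6 * Num.sqrt 6) =
    (block k)%:R ^+ 6 / (k%:R * Num.sqrt k%:R).
  rewrite /t sqrtrM // sqrtrV // /block_start natrM natrX.
  rewrite sqrtrM // (_ : (block k)%:R ^+ 4 = ((block k)%:R ^+ 2) ^+ 2); last by rewrite -exprM.
  rewrite sqrtr_sqr ger0_norm ?sqr_ge0 //.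
  by field; rewrite !gt_eqF ?sqrtr_gt0.
rewrite /u tE /packing_extent /ring_outer /pow32 /i !(natrX, natrM, natrD).
by field; rewrite !gt_eqF ?sqrtr_gt0.
Unshelve. all: by end_near. Qed.

End Packing.

(** * Filling an octagon of linear size *)

Lemma block_length_ge j : (24 * j ^ 3 <= block_start j.+1 - block_start j)%N.
Proof. by rewrite leq_subRL /block_start !expnS !expn0; nia. Qed.

(** Rounding towards zero decreases the absolute values of the coordinates,
    so the rounded point stays in the octagon. *)
Lemma round_to_zero (h : nat) (x : int) : (0 < h)%N ->
  exists y : int, (h * `|y| <= `|x|)%N /\ (`|(x - h%:Z * y)%R| <= h)%N.
Proof.
move=> h0; have e := divn_eq `|x| h; have lt := ltn_pmod `|x| h0.
case: x e lt => n; rewrite ?absz_nat ?abszN; set q := (_ %/ h)%N; 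
  set t := (_ %% h)%N => e lt.
  by exists q%:Z; rewrite absz_nat; split; nia.
by exists (- q%:Z); rewrite abszN absz_nat; split; nia.
Qed.

Section Covering.
Variables (R : realType) (u d : R).
Hypotheses (u_ge1 : 1 <= u) (d_ge0 : 0 <= d) (d_le : d <= u).
Hypothesis ud_ge1 : 1 <= 2 * u - d.

Let U T := Num.trunc (u * T%:R : R).
Let L T := Num.trunc ((2 * u - d) * T%:R : R).

(** The integer points of the octagon [|x|, |y| <= u T],
    [|x| + |y| <= (2 u - d) T]. *)
Definition in_region (T : nat) (p : int * int) : bool :=
  (sup_norm p <= U T)%N && (l1_norm p <= L T)%N.

Definition region (T : nat) : {fset int * int} :=
  [fset p in box (U T) | in_region T p]%fset.

Lemma in_regionE T p : (p \in region T) = in_region T p.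
Proof. by rewrite in_fset /= inE /= in_boxE /in_region; case: (_ <= U T)%N. Qed.

Let u_ge0 : 0 <= u. Proof. exact: le_trans u_ge1. Qed.
Let ud_ge0 : 0 <= 2 * u - d. Proof. exact: le_trans ud_ge1. Qed.

Lemma in_regionP T p : in_region T p =
  ((sup_norm p)%:R <= u * T%:R) && ((l1_norm p)%:R <= (2 * u - d) * T%:R).
Proof. by rewrite /in_region !truncn_ge_nat // mulr_ge0. Qed.

(** The octagon of parameter [1] contains the unit diamond, by the two lower
    bounds on [u] and [2 u - d]; being convex, its dilates then absorb the spread
    of the fire. *)
Lemma region_spread k m n p q : (k <= m <= n)%N -> in_region k p ->
  (l1_dist q p <= n - m)%N -> in_region n q.
Proof.
move=> /andP[km mn]; rewrite !in_regionP => /andP[h1 h2] qp.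
have dR : (l1_dist q p)%:R <= n%:R - m%:R :> R by rewrite -natrB // ler_nat.
have s1 : (sup_norm q)%:R <= (sup_norm p)%:R + (l1_dist q p)%:R :> R.
  by rewrite -natrD ler_nat sup_norm_dist.
have s2 : (l1_norm q)%:R <= (l1_norm p)%:R + (l1_dist q p)%:R :> R.
  by rewrite -natrD ler_nat l1_norm_dist.
have grow (y : R) : 1 <= y -> y * k%:R + (n%:R - m%:R) <= y * n%:R.
  move=> y1; have kmR : k%:R <= m%:R :> R by rewrite ler_nat.
  have mnR : 0 <= n%:R - m%:R :> R by rewrite subr_ge0 ler_nat.
  have : 0 <= (y - 1) * (n%:R - m%:R) by rewrite mulr_ge0 // subr_ge0.
  have : y * k%:R <= y * m%:R by rewrite ler_wpM2l // (le_trans _ y1).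
  by rewrite mulrBl mul1r mulrBr; lra.
have := grow _ u_ge1; have := grow _ ud_ge1.
by move=> g1 g2; apply/andP; split; lra.
Qed.

Lemma region_card_ratio :
  #|` region T|%:R / T%:R ^+ 2 @[T --> \oo] --> (4 * u ^+ 2 - 2 * d ^+ 2 : R).
Proof.
pose F T := U T; pose D T := Num.trunc (d * T%:R : R).
have DF T : (D T <= F T)%N by apply: le_truncn; rewrite ler_wpM2r.
pose k1 T : R := (F T)%:R / T%:R; pose k2 T : R := (D T)%:R / T%:R.
pose i (T : nat) : R := T%:R^-1.
have card_oct G E : (E <= G)%N ->
    #|` octagon G E|%:R = (2 * G%:R + 1) ^+ 2 - 2 * E%:R * (E%:R + 1) :> R.
  move=> /card_octagon /(congr1 (fun n => n%:R : R)).
  rewrite -[(2 * G).+1]addn1 -[E.+1]addn1 !(natrX, natrM, natrD) => <-.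
  by rewrite addrK.
apply: (@squeeze_cvgr _ _ _ _
  (fun T => (2 * (k1 T - i T) + i T) ^+ 2 - 2 * k2 T ^+ 2)
  (fun T => (2 * (k1 T + i T) + i T) ^+ 2 - 2 * k2 T ^+ 2)).
- near=> T; have T0 : (0 < T)%N by near: T; exact: nbhs_infty_gt.
  have T0R : (0 : R) < T%:R by rewrite ltr0n.
  have [Fu uF] : (F T)%:R <= u * T%:R /\ u * T%:R < (F T)%:R + 1.
    by have /andP[] := truncn_itv (mulr_ge0 u_ge0 (ltW T0R)); rewrite -natr1.
  have [Dd dD] : (D T)%:R <= d * T%:R /\ d * T%:R < (D T)%:R + 1.
    by have /andP[] := truncn_itv (mulr_ge0 d_ge0 (ltW T0R)); rewrite -natr1.
  have F1 : (0 < F T)%N.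
    by rewrite truncn_gt0 (le_trans u_ge1) // ler_peMr // ler1n.
  apply/andP; split.
    have -> : (2 * (k1 T - i T) + i T) ^+ 2 - 2 * k2 T ^+ 2 =
      ((2 * ((F T)%:R - 1) + 1) ^+ 2 - 2 * (D T)%:R ^+ 2) / T%:R ^+ 2.
      by rewrite /k1 /k2 /i; field; rewrite gt_eqF.
    rewrite ler_pM2r ?invr_gt0 ?exprn_gt0 //.
    have E1 : ((D T).-1 <= (F T).-1)%N by rewrite -!subn1 leq_sub2r.
    have FE : (F T).-1%:R = (F T)%:R - 1 :> R by rewrite -subn1 natrB.
    apply: (@le_trans _ _ #|` octagon (F T).-1 (D T).-1|%:R).
      rewrite card_oct // FE lerD2l lerN2 -mulrA ler_pM2l // expr2.
      by case: (D T) => [|D'] /=; rewrite ?mul0r // natr1 ler_wpM2r // ler_nat.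
    rewrite ler_nat; apply/fsubset_leq_card/fsubsetP => p.
    rewrite in_octagon // in_regionE in_regionP => /andP[p1 p2].
    move: p1 p2; rewrite -!(ler_nat R) => p1 p2; apply/andP; split.
      by apply: (le_trans p1); rewrite FE; lra.
    apply: (le_trans p2); rewrite natrB; last by rewrite (leq_trans E1) // leq_pmull.
    rewrite natrM FE mulrBl.
    case: (D T) dD => [|D'] /=; first by lra.
    by rewrite -natr1; lra.
  have -> : (2 * (k1 T + i T) + i T) ^+ 2 - 2 * k2 T ^+ 2 =
      ((2 * ((F T)%:R + 1) + 1) ^+ 2 - 2 * (D T)%:R ^+ 2) / T%:R ^+ 2.
    by rewrite /k1 /k2 /i; field; rewrite gt_eqF.
  rewrite ler_pM2r ?invr_gt0 ?exprn_gt0 //.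
  apply: (@le_trans _ _ #|` octagon (F T).+1 (D T)|%:R); last first.
    rewrite card_oct; last by rewrite ltnW // ltnS.
    rewrite -[(F T).+1%:R]natr1 lerD2l lerN2 mulrDr mulr1 -mulrA -expr2.
    by rewrite lerDl mulr_ge0.
  rewrite ler_nat; apply/fsubset_leq_card/fsubsetP => p.
  rewrite in_octagon; last by rewrite ltnW // ltnS.
  rewrite in_regionE => /andP[p1]; rewrite (leqW p1) /=.
  rewrite truncn_ge_nat; last by rewrite mulr_ge0.
  move=> p2; rewrite -ltnS -(ltr_nat R) -natr1.
  rewrite natrB; last by rewrite (leq_trans (DF T)) // mulnS addnC mul2n -addnn -addnA leq_addr.
  by rewrite natrM -natr1; lra.
- have -> : 4 * u ^+ 2 - 2 * d ^+ 2 = (2 * (u - 0) + 0) ^+ 2 - 2 * d ^+ 2.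
    by ring.
  apply: cvgB; last by apply: cvgM; [exact: cvg_cst|exact/cvg_power/trunc_cvg_ratio].
  apply: cvg_power; apply: cvgD; last exact: inv_nat_cvg0.
  apply: cvgM; first exact: cvg_cst.
  by apply: cvgB; [exact: trunc_cvg_ratio|exact: inv_nat_cvg0].
- have -> : 4 * u ^+ 2 - 2 * d ^+ 2 = (2 * (u + 0) + 0) ^+ 2 - 2 * d ^+ 2.
    by ring.
  apply: cvgB; last by apply: cvgM; [exact: cvg_cst|exact/cvg_power/trunc_cvg_ratio].
  apply: cvg_power; apply: cvgD; last exact: inv_nat_cvg0.
  apply: cvgM; first exact: cvg_cst.
  by apply: cvgD; [exact: trunc_cvg_ratio|exact: inv_nat_cvg0].
Unshelve. all: by end_near. Qed.

Definition dilate (h : nat) (w : int * int) : int * int :=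
  (h%:Z * w.1, h%:Z * w.2).

(** The step [j^3] is negligible against the size [j^4] of the region, yet
    coarse enough for the mesh, of order [j^2] points, to fit in a block of
    length [24 j^3 + O(j^2)]. *)
Definition mesh (j : nat) : seq (int * int) :=
  [seq q <- [seq dilate (j ^ 3) w | w <- box (Num.trunc (6 * u * j%:R))] |
    in_region (block_start j) q].

Definition covering : nat -> int * int := in_blocks mesh.

Let in_region0 T : in_region T 0.
Proof. by []. Qed.

Lemma covering_in_region k : in_region k (covering k).
Proof.
have H : in_region (block_start (block k)) (covering k).
  rewrite /covering /in_blocks.
  have [lt|ge] := ltnP (k - block_start (block k)) (size (mesh (block k))).
    by have := mem_nth (0, 0) lt; rewrite mem_filter => /andP[].
  by rewrite nth_default // in_region0.
apply: (@region_spread _ k k _ _ _ H); last by rewrite /l1_dist subrr.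
by have /andP[-> _] := block_bounds k; rewrite leqnn.
Qed.

Lemma mesh_covers : exists j0, forall j z, (j0 <= j)%N ->
  in_region (block_start j) z ->
  exists k, block k = j /\ (l1_dist z (covering k) <= 2 * j ^ 3)%N.
Proof.
(* From [j0] on, [(12 u j + 1)^2 <= 24 j^3], so the block lists the whole mesh. *)
have u0 := u_ge0; pose j0 := (Num.trunc ((12 * u + 1) ^+ 2)).+1.
exists j0 => j z j0j zT.
have j_gt0 : (0 < j)%N by exact: leq_trans j0j.
have j3 : (0 < j ^ 3)%N by rewrite expn_gt0 j_gt0.
have j_big : (12 * u + 1) ^+ 2 <= j%:R.
  by apply: (le_trans (ltW (truncnS_gt _))); rewrite ler_nat.
set W := Num.trunc (6 * u * j%:R).
have W_le : W%:R <= 6 * u * j%:R by rewrite truncn_le !mulr_ge0.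
have [y1 [y1le y1d]] := @round_to_zero (j ^ 3) z.1 j3.
have [y2 [y2le y2d]] := @round_to_zero (j ^ 3) z.2 j3.
pose q := dilate (j ^ 3) (y1, y2).
have qz : (sup_norm q <= sup_norm z)%N /\ (l1_norm q <= l1_norm z)%N.
  rewrite /q /sup_norm /l1_norm /dilate /= !abszM !absz_nat; split.
    by rewrite geq_max !leq_max y1le y2le orbT.
  exact: leq_add.
have qT : in_region (block_start j) q.
  move: zT; rewrite /in_region => /andP[h1 h2].
  by rewrite (leq_trans qz.1 h1) (leq_trans qz.2 h2).
have q_mesh : q \in mesh j.
  rewrite mem_filter qT; apply/mapP; exists (y1, y2) => //.
  rewrite in_boxE /W truncn_ge_nat; last by rewrite !mulr_ge0.
  have jR : (0 : R) < (j ^ 3)%:R by rewrite ltr0n.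
  rewrite -(ler_pM2r jR) -natrM.
  have -> : 6 * u * j%:R * (j ^ 3)%:R = u * (block_start j)%:R.
    by rewrite /block_start natrM !natrX; ring.
  have := qT; rewrite in_regionP => /andP[h _]; apply: le_trans h.
  by rewrite ler_nat /q /sup_norm /dilate /= !abszM !absz_nat -maxnMr mulnC.
have size_mesh : (size (mesh j) <= block_start j.+1 - block_start j)%N.
  apply: (@leq_trans ((2 * W).+1 ^ 2)).
    by rewrite -card_box size_filter (leq_trans (count_size _ _)) // size_map.
  apply: (@leq_trans (24 * j ^ 3)); last first.
    exact: block_length_ge.
  rewrite -(ler_nat R) -[(2 * W).+1]addn1 !(natrX, natrM, natrD).
  apply: (@le_trans _ _ ((12 * u + 1) ^+ 2 * j%:R ^+ 2)).
    rewrite -exprMn ler_pXn2r ?nnegrE ?addr_ge0 ?mulr_ge0 ?addr_ge0 ?mulr_ge0 //.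
    have : 1 <= j%:R :> R by rewrite ler1n.
    by lra.
  apply: (@le_trans _ _ (j%:R * j%:R ^+ 2)); first by rewrite ler_wpM2r.
  by rewrite -exprS ler_peMl ?exprn_ge0 // ler1n.
pose k := (block_start j + index q (mesh j))%N.
have idx : (index q (mesh j) < size (mesh j))%N by rewrite index_mem.
have kj : block k = j.
  apply: blockE; rewrite leq_addr /= -ltn_subRL.
  exact: leq_trans size_mesh.
exists k; split => //.
have -> : covering k = q.
  by rewrite /covering /in_blocks kj /k addKn nth_index.
by rewrite mul2n -addnn; exact: leq_add.
Qed.

Section CoveringBurn.
Variables (f : nat -> nat) (v : nat -> option (int * int)) (m : nat -> nat).
Hypothesis incr_f : strictly_increasing_pos f.
Hypothesis act_v : is_activator_sequence f v.
Hypothesis v_covering : forall n q, v n = Some q ->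
  exists2 k, (k < n)%N & covering k = q.
Hypothesis burned_m : forall n k q, (m k <= n)%N ->
  (l1_dist q (covering k) <= n - m k)%N -> q \in burned f v n.
Hypothesis m_le : forall x : R, 1 < x ->
  \forall k \near \oo, (m k)%:R <= x * k%:R.

Let X n : R := #|` burned f v n|%:R / n%:R ^+ 2.

Lemma covering_burned_le : eventually_le X (4 * u ^+ 2 - 2 * d ^+ 2).
Proof.
apply: (@eventually_le_trans _ _ _ _ _ region_card_ratio).
near=> n; rewrite /X ler_wpM2r ?invr_ge0 ?exprn_ge0 // ler_nat.
apply/fsubset_leq_card/fsubsetP => q /burnedP[] // l [p [ln vl qp]].
rewrite in_regionE; have [k kl kp] := v_covering _ _ vl.
apply: (@region_spread k l n p q) => //; last by rewrite -kp covering_in_region.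
by rewrite (ltnW kl); case/andP: ln.
Unshelve. all: by end_near. Qed.

(** At time [n], the last block that ends before [n / x] is completely lit,
    and its fires have had the time to close the gaps of the mesh: the
    region of that block is burned. *)
Lemma covering_slack_ge x : 1 < x ->
  eventually_ge X ((4 * u ^+ 2 - 2 * d ^+ 2) * (1 / x) ^+ 2).
Proof.
move=> x1; have x0 : 0 < x by exact: lt_trans x1.
pose n' n := Num.trunc (x^-1 * n%:R); pose j n := (block (n' n)).-1.
have n'_oo : n' n @[n --> \oo] --> \oo by apply: trunc_cvg_infty; rewrite invr_gt0.
have bn'_oo : block (n' n) @[n --> \oo] --> \oo.
  exact: (cvg_comp _ _ n'_oo block_cvg_infty).
have j_oo : j n @[n --> \oo] --> \oo.
  apply/cvgnyPge => A; move/cvgnyPge: bn'_oo => /(_ A.+1).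
  by apply: filterS => n; rewrite /j; lia.
have T_oo : block_start (j n) @[n --> \oo] --> \oo.
  apply/cvgnyPge => A; move/cvgnyPge: j_oo => /(_ A).
  apply: filterS => n An; apply: (leq_trans An).
  by have := leq_exp4 (j n); rewrite /block_start; lia.
pose y := (1 + x) / 2; have [y1 yx] : 1 < y /\ y < x by rewrite /y; split; lra.
have sub : \forall n \near \oo,
    #|` region (block_start (j n))|%:R <= #|` burned f v n|%:R :> R.
  have [j0 cov] := mesh_covers.
  have [K _ mK] := m_le y y1.
  pose C : R := (3 * (x - y))^-1.
  near=> n.
  have n0 : (0 < block (n' n))%N.
    by near: n; move/cvgnyPgt: bn'_oo; apply.
  have j0j : (j0 <= j n)%N by near: n; move/cvgnyPge: j_oo; apply.
  have j1 : (0 < j n)%N by near: n; move/cvgnyPgt: j_oo; apply.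
  have KT : (K <= block_start (j n))%N.
    by near: n; move/cvgnyPge: T_oo; apply.
  have Cj : (Num.trunc C < j n)%N by near: n; move/cvgnyPgt: j_oo; apply.
  rewrite ler_nat; apply/fsubset_leq_card/fsubsetP => q; rewrite in_regionE => qT.
  have [k [kj qk]] := cov _ _ j0j qT.
  have /andP[k1 k2] := block_bounds k; have /andP[b1 b2] := block_bounds (n' n).
  rewrite kj in k1 k2; have jE : (j n).+1 = block (n' n) by rewrite prednK.
  rewrite jE in k2.
  have kn' : (k <= n' n)%N by exact: leq_trans (ltnW k2) b1.
  have mk : (m k)%:R <= y * k%:R by apply: mK => /=; exact: leq_trans k1.
  have nn' : x * (n' n)%:R <= n%:R.
    by rewrite mulrC -ler_pdivlMr // mulrC truncn_le mulr_ge0 // invr_ge0 ltW.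
  have room : (m k)%:R + (2 * j n ^ 3)%:R <= n%:R :> R.
    apply: le_trans nn'; have -> : x = y + (x - y) by ring.
    rewrite mulrDl lerD //.
      by apply: (le_trans mk); rewrite ler_pM2l ?ler_nat // (lt_trans _ y1).
    have jT : (6 * j n ^ 4 <= n' n)%N by apply: leq_trans b1; rewrite -jE; exact: block_start_mono.
    apply: (@le_trans _ _ ((x - y) * (6 * j n ^ 4)%:R)); last first.
      by rewrite ler_pM2l ?subr_gt0 // ler_nat.
    have Cj' : C <= (j n)%:R.
      by apply: (le_trans (ltW (truncnS_gt _))); rewrite ler_nat.
    have xy : 0 < 3 * (x - y) by rewrite mulr_gt0 // subr_gt0.
    rewrite /C -div1r ler_pdivrMr // in Cj'.
    rewrite !(natrX, natrM).
    have j3 : (0 : R) <= (j n)%:R ^+ 3 by rewrite exprn_ge0.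
    have -> : (x - y) * (6 * (j n)%:R ^+ 4) =
      2 * (j n)%:R ^+ 3 * ((j n)%:R * (3 * (x - y))) by ring.
    by rewrite ler_peMr // mulr_ge0.
  rewrite -natrD ler_nat in room.
  have mn : (m k <= n)%N by exact: leq_trans (leq_addr _ _) room.
  by apply: (burned_m n k) => //; rewrite (leq_trans qk) // leq_subRL.
pose W n : R := #|` region (block_start (j n))|%:R / (block_start (j n))%:R ^+ 2
  * ((1 - (block (n' n))%:R^-1) ^+ 4 *
     ((block_start (block (n' n)))%:R / (n' n)%:R) * ((n' n)%:R / n%:R)) ^+ 2.
have Wcvg : W n @[n --> \oo] --> ((4 * u ^+ 2 - 2 * d ^+ 2) *
    ((1 - 0) ^+ 4 * 1 * x^-1) ^+ 2 : R).
  apply: cvgM; first exact: (cvg_comp _ _ T_oo region_card_ratio).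
  apply: cvg_power; apply: cvgM; last first.
    by apply: trunc_cvg_ratio; rewrite invr_ge0 ltW.
  apply: cvgM; last exact: (cvg_comp _ _ n'_oo (block_ratio R)).
  apply: cvg_power; apply: cvgB; first exact: cvg_cst.
  exact: (cvg_comp _ _ bn'_oo (inv_nat_cvg0 R)).
rewrite subr0 expr1n !mul1r -div1r in Wcvg.
apply: (@eventually_ge_trans _ _ _ _ _ Wcvg); near=> n.
have cn : #|` region (block_start (j n))|%:R <= #|` burned f v n|%:R :> R.
  by near: n.
have n_gt0 : (0 : R) < n%:R by rewrite ltr0n; near: n; exact: nbhs_infty_gt.
have n'_gt0 : (0 : R) < (n' n)%:R.
  by rewrite ltr0n; near: n; move/cvgnyPgt: n'_oo; apply.
have j_gt0 : (0 : R) < (j n)%:R.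
  by rewrite ltr0n; near: n; move/cvgnyPgt: j_oo; apply.
have b_gt0 : (0 < block (n' n))%N by near: n; move/cvgnyPgt: bn'_oo; apply.
rewrite /X ler_pdivlMr ?exprn_gt0 //; apply: le_trans cn.
rewrite le_eqVlt; apply/orP; left; apply/eqP; rewrite /W.
have -> : block (n' n) = (j n).+1 by rewrite prednK.
rewrite /block_start !(natrX, natrM) -[(j n).+1%:R]natr1.
field.
by rewrite !gt_eqF // ltr_wpDl.
Unshelve. all: by end_near. Qed.

Lemma covering_burned_ge : eventually_ge X (4 * u ^+ 2 - 2 * d ^+ 2).
Proof.
move=> l ll; pose x k : R := 1 + k%:R^-1; set A := 4 * u ^+ 2 - 2 * d ^+ 2.
have Acvg : A * (1 / x k) ^+ 2 @[k --> \oo] --> (A * (1 / (1 + 0)) ^+ 2 : R).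
  apply: cvgM; first exact: cvg_cst.
  apply: cvg_power; apply: cvgM; first exact: cvg_cst.
  apply: cvgV; first by rewrite addr0 oner_neq0.
  by apply: cvgD; [exact: cvg_cst|exact: inv_nat_cvg0].
rewrite addr0 divr1 expr1n mulr1 in Acvg.
have [k _ kP] := cvgr_gt _ Acvg _ ll.
apply: (covering_slack_ge (x k.+1)) (kP k.+1 (leqnSn k)).
by rewrite /x ltrDl invr_gt0 ltr0n.
Qed.

End CoveringBurn.
End Covering.

(** * The sets of burning densities *)

Section MainTheorem.
Variables (R : realType) (f : nat -> nat) (c : R).
Hypothesis incr_f : strictly_increasing_pos f.
Hypothesis c_gt0 : 0 < c.

Let grid_y_gt0 : 0 < 4 * c ^+ 2.
Proof. by rewrite mulr_gt0 // exprn_gt0. Qed.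

Section Linear.
Hypothesis f_linear : (f n)%:R / n%:R @[n --> \oo] --> c.
Hypothesis c_ge1 : 1 <= c.

Let grid_quadratic :
  (2 * (f n)%:R + 1) ^+ 2 / n%:R ^+ 2 @[n --> \oo] --> 4 * c ^+ 2.
Proof.
have -> : 4 * c ^+ 2 = (2 * c + 0) ^+ 2 by ring.
have -> : (fun n => (2 * (f n)%:R + 1) ^+ 2 / n%:R ^+ 2) =
    (fun n => (2 * ((f n)%:R / n%:R) + n%:R^-1) ^+ 2 : R).
  by apply/funext => n; rewrite -expr_div_n mulrDl -mulrA div1r.
apply: cvg_power; apply: cvgD; last exact: inv_nat_cvg0.
by apply: cvgM => //; exact: cvg_cst.
Qed.

Lemma linear_density_ge v : is_activator_sequence f v ->
  1 / (2 * c ^+ 2) <= lower_density R f v.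
Proof.
move=> act_v; have -> : 1 / (2 * c ^+ 2) = 2 / (4 * c ^+ 2).
  by field; rewrite gt_eqF.
apply: lower_density_ge => //; apply: burned_ratio_ge grid_quadratic _ => //.
have [_ [m m0 vm]] := act_v; case vE : (v m) vm => [p|] // _.
pose W n : R := 2 * (1 - m%:R * n%:R^-1) ^+ 2.
have Wcvg : W n @[n --> \oo] --> (2 * (1 - m%:R * 0) ^+ 2 : R).
  apply: cvgM; first exact: cvg_cst.
  apply: cvg_power; apply: cvgB; first exact: cvg_cst.
  by apply: cvgM; [exact: cvg_cst|exact: inv_nat_cvg0].
rewrite mulr0 subr0 expr1n mulr1 in Wcvg.
apply: (@eventually_ge_trans _ _ _ _ _ Wcvg); near=> n.
have mn : (m <= n)%N by near: n; exists m.
have n0 : (0 : R) < n%:R by rewrite ltr0n (leq_trans m0).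
rewrite ler_pdivlMr ?exprn_gt0 //.
have -> : W n * n%:R ^+ 2 = (2 * (n - m) ^ 2)%:R.
  by rewrite natrM natrX natrB // /W; field; rewrite gt_eqF.
by rewrite ler_nat; apply: burned_ge_ball vE; rewrite // m0.
Unshelve. all: by end_near. Qed.

(** With [g k] the integral part of [u k], the condition [u <= c] is what makes
    the covering fit in the grid after a negligible delay. *)
Let linear_realization u d : 1 <= u -> u <= c -> 0 <= d -> d <= u ->
  1 <= 2 * u - d ->
  burning_densities R f ((4 * u ^+ 2 - 2 * d ^+ 2) / (4 * c ^+ 2)).
Proof.
move=> u1 uc d0 du ud; have u0 : 0 <= u by exact: le_trans u1.
pose p := covering R u d; pose g k := Num.trunc (u * k%:R : R).
have pg k : (sup_norm (p k) <= g k)%N.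
  by have /andP[] := covering_in_region R u d u1 ud k.
have gf : forall x : R, 1 < x ->
    \forall k \near \oo, forall m, x * k%:R <= m%:R -> (g k <= f m)%N.
  apply: (@eventually_le_shift R (fun n => n%:R) f g u c) => //.
    by move=> n; rewrite ltr0n.
  exact: trunc_cvg_ratio.
have [v [m [act_v vp m_le bm]]] := schedule R f incr_f p g pg gf.
have le := covering_burned_le R u d u1 d0 du ud f v incr_f act_v vp.
have ge := covering_burned_ge R u d u1 d0 du ud f v m bm m_le.
have H : has_burning_density R f v ((4 * u ^+ 2 - 2 * d ^+ 2) / (4 * c ^+ 2)).
  apply: has_density => //.
  - by apply: burned_ratio_le grid_quadratic _.
  - by apply: burned_ratio_ge grid_quadratic _.
split; last by exists v.
have d2 : d ^+ 2 <= u ^+ 2 by rewrite ler_pXn2r // nnegrE.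
have u2 : u ^+ 2 <= c ^+ 2 by rewrite ler_pXn2r // nnegrE // ltW.
have d20 : 0 <= d ^+ 2 by rewrite exprn_ge0.
apply/andP; split; first by rewrite divr_ge0 ?(ltW grid_y_gt0) //; lra.
by rewrite ler_pdivrMr //; lra.
Qed.

Lemma linear_densities :
  burning_densities R f = `[1 / (2 * c ^+ 2), 1]%classic.
Proof.
apply/seteqP; split => [rho [/andP[_ rho1] [v [act_v [low _]]]]|rho] /=.
  by rewrite in_itv /= rho1 -low linear_density_ge.
rewrite in_itv /= => /andP[rho_ge rho1].
have c2 : 0 < c ^+ 2 by rewrite exprn_gt0.
have rho0 : 0 <= rho by apply: le_trans rho_ge; rewrite divr_ge0 // mulr_ge0 // ltW.
have {}rho_ge : 1 <= 2 * (c ^+ 2 * rho).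
  by rewrite ler_pdivrMr ?mulr_gt0 // in rho_ge; lra.
(* Up to density [1 / c^2] the octagons between the unit diamond and the
   unit square suffice; beyond, squares do. *)
have [small|big] := leP (c ^+ 2 * rho) 1.
  pose d := Num.sqrt (2 - 2 * (c ^+ 2 * rho)).
  have dE : d ^+ 2 = 2 - 2 * (c ^+ 2 * rho) by rewrite sqr_sqrtr //; lra.
  have d0 : 0 <= d by rewrite sqrtr_ge0.
  have d1 : d <= 1.
    by rewrite -(ler_pXn2r (n := 2)) ?nnegrE // expr1n dE; lra.
  have -> : rho = (4 * 1 ^+ 2 - 2 * d ^+ 2) / (4 * c ^+ 2).
    by rewrite dE; field; rewrite gt_eqF.
  by apply: linear_realization => //; lra.
pose u := c * Num.sqrt rho.
have uE : u ^+ 2 = c ^+ 2 * rho by rewrite exprMn sqr_sqrtr.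
have u0 : 0 <= u by rewrite mulr_ge0 ?sqrtr_ge0 // ltW.
have u1 : 1 <= u.
  by rewrite -(ler_pXn2r (n := 2)) ?nnegrE // expr1n uE ltW.
have uc : u <= c.
  rewrite /u ler_piMr ?(ltW c_gt0) // -(@sqrtr1 R) ler_wsqrtr //.
have -> : rho = (4 * u ^+ 2 - 2 * 0 ^+ 2) / (4 * c ^+ 2).
  by rewrite uE; field; rewrite gt_eqF.
by apply: linear_realization => //; lra.
Qed.

End Linear.

Section ThreeHalves.
Hypothesis f_pow32 : (f n)%:R / pow32 n @[n --> \oo] --> c.

Let grid_cubic :
  (2 * (f n)%:R + 1) ^+ 2 / n%:R ^+ 3 @[n --> \oo] --> 4 * c ^+ 2.
Proof.
have -> : 4 * c ^+ 2 = (2 * c + 0 * 0) ^+ 2 by ring.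
have -> : (fun n => (2 * (f n)%:R + 1) ^+ 2 / n%:R ^+ 3) =
    (fun n => (2 * ((f n)%:R / pow32 n) + n%:R^-1 * (Num.sqrt n%:R)^-1) ^+ 2 : R).
  apply/funext => n; rewrite -pow32_sqr -expr_div_n mulrDl -mulrA div1r.
  by rewrite -invfM.
apply: cvg_power; apply: cvgD.
  by apply: cvgM => //; exact: cvg_cst.
by apply: cvgM; [exact: inv_nat_cvg0|exact: inv_sqrt_nat_cvg0].
Qed.

Let w : R := Num.sqrt 6.
Let w_gt0 : 0 < w. Proof. by rewrite sqrtr_gt0. Qed.

Lemma pow32_density_le v : is_activator_sequence f v ->
  upper_density R f v <= (1 + Num.sqrt 6 * c) ^- 2.
Proof.
move=> act_v; have w0 := w_gt0.
have -> : (1 + Num.sqrt 6 * c) ^- 2 =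
    4 * c ^+ 2 / (1 + Num.sqrt 6 * c) ^+ 2 / (4 * c ^+ 2).
  field; rewrite !gt_eqF //= ?addr_gt0 ?mulr_gt0 //.
apply: upper_density_le => //; apply: burned_ratio_le grid_cubic _ => //.
apply: (@burned_eventually_le R f v incr_f act_v f c) => //; last exact: ltW.
  move=> m p m0 vm; rewrite -in_boxE.
  exact: (proj1 act_v).
by move=> m n m0 mn; have := @increase_ge f incr_f m n m0 mn; lia.
Qed.

Let pow32_grow (x : R) k m : 1 < x -> x * k%:R <= m%:R -> x * pow32 k <= pow32 m.
Proof.
move=> x1 km; have x0 : 0 <= x by rewrite ltW // (lt_trans _ x1).
rewrite mulrA; apply: ler_pM; rewrite ?sqrtr_ge0 ?mulr_ge0 //.
by rewrite ler_wsqrtr // (le_trans _ km) // ler_peMl // ltW.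
Qed.

(** The density [a^2 / (c (1 + w a))^2] increases with [a] from [0] to its value
    at [a = c]. *)
Let pow32_realization a : 0 < a -> a <= c ->
  burning_densities R f (4 * a ^+ 2 / (1 + w * a) ^+ 2 / (4 * c ^+ 2)).
Proof.
move=> a0 ac; have w0 := w_gt0; have b0 : 0 < w * a by rewrite mulr_gt0.
have gf := @eventually_le_shift R pow32 f (packing_extent R a) a c c_gt0 ac
  (@pow32_gt0 R) pow32_grow (packing_extent_ratio R a a0) f_pow32.
have [v [m [act_v vp m_le bm]]] :=
  schedule R f incr_f _ _ (packing_le_extent R a a0) gf.
have le := @burned_eventually_le R f v incr_f act_v (packing_extent R a) a.
have ge := @burned_eventually_ge R f v _ m (packing_radius R a) (w * a) b0 bm m_le
  (packing_radius_ge R a a0) (packing_disjoint R a a0).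
have bE : 2 / 3 * (w * a) ^+ 2 / (1 + w * a) ^+ 2 = 4 * a ^+ 2 / (1 + w * a) ^+ 2.
  rewrite exprMn (_ : w ^+ 2 = 6); last by rewrite sqr_sqrtr.
  by field; rewrite gt_eqF // addr_gt0.
rewrite bE in ge.
have H : has_burning_density R f v (4 * a ^+ 2 / (1 + w * a) ^+ 2 / (4 * c ^+ 2)).
  apply: has_density => //.
  - apply: burned_ratio_le grid_cubic _ => //; apply: le => //.
    + move=> l q l0 /vp[k kl <-].
      apply: (leq_trans (packing_le_extent R a a0 k)).
      by apply: packing_extent_mono => //; exact: ltnW.
    + by move=> l n _ ln; exact: packing_extent_mono.
    + exact: ltW.
    + exact: packing_extent_ratio.
  - by apply: burned_ratio_ge grid_cubic _.
split; last by exists v.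
apply/andP; split.
  by rewrite !divr_ge0 ?exprn_ge0 ?mulr_ge0 ?addr_ge0 ?ltW.
rewrite ler_pdivrMr // ler_pdivrMr ?exprn_gt0 ?addr_gt0 // mul1r.
have a2 : a ^+ 2 <= c ^+ 2 by rewrite ler_pXn2r // nnegrE ltW.
apply: (@le_trans _ _ (4 * c ^+ 2)); first by rewrite ler_pM2l.
by rewrite ler_peMr ?(ltW grid_y_gt0) // exprn_ege1 // lerDl ltW.
Qed.

(** A single fire, of area of order [n^2]. *)
Let zero_realization : burning_densities R f 0.
Proof.
split; first by rewrite lexx ler01.
pose v n : option (int * int) := if n == 1%N then Some (0, 0) else None.
have act_v : is_activator_sequence f v.
  split; last by exists 1%N.
  by move=> n x n0; rewrite /v; case: eqP => // _ [<-]; rewrite /grid_vertices in_boxE.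
exists v; split => //; rewrite -(mul0r (4 * c ^+ 2)^-1).
apply: has_density => //.
- apply: burned_ratio_le grid_cubic _ => //.
  have -> : 0 = 4 * 0 ^+ 2 / (1 + Num.sqrt 6 * 0) ^+ 2 :> R.
    by rewrite expr0n mulr0 mul0r.
  apply: (@burned_eventually_le R f v incr_f act_v (fun=> 0%N)) => //.
    by move=> m p _; rewrite /v; case: eqP => // _ [<-].
  under eq_cvg do rewrite mul0r; exact: cvg_cst.
- apply: burned_ratio_ge grid_cubic _ => // l l0; near=> n.
  by apply: (le_trans (ltW l0)); rewrite divr_ge0 ?exprn_ge0.
Unshelve. all: by end_near. Qed.

Lemma pow32_densities :
  burning_densities R f = `[0, (1 + Num.sqrt 6 * c) ^- 2]%classic.
Proof.
have w0 := w_gt0; have wc : 0 < w * c by rewrite mulr_gt0.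
apply/seteqP; split => [rho [/andP[rho0 _] [v [act_v [_ up]]]]|rho] /=.
  by rewrite in_itv /= rho0 -up pow32_density_le.
rewrite in_itv /= le_eqVlt => /andP[/predU1P[<- _|rho0 rho_le]].
  exact: zero_realization.
pose s := Num.sqrt rho; have s0 : 0 < s by rewrite sqrtr_gt0.
have sE : s ^+ 2 = rho by rewrite sqr_sqrtr // ltW.
have s_le : s <= (1 + w * c)^-1.
  have inv0 : 0 <= (1 + w * c)^-1 by rewrite invr_ge0 ltW // addr_gt0.
  by rewrite -(ler_pXn2r (n := 2)) ?nnegrE ?(ltW s0) // sE exprVn.
rewrite -[leRHS]div1r ler_pdivlMr in s_le; last by rewrite addr_gt0.
have den : 0 < 1 - w * c * s by rewrite mulrDr in s_le; lra.
(* The solution of [a / (1 + w a) = c s]. *)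
pose a := c * s / (1 - w * c * s).
have a0 : 0 < a by rewrite divr_gt0 // mulr_gt0.
have ac : a <= c.
  rewrite /a ler_pdivrMr // ler_pM2l //.
  by rewrite mulrDr in s_le; lra.
have -> : rho = 4 * a ^+ 2 / (1 + w * a) ^+ 2 / (4 * c ^+ 2).
  have e : a / (1 + w * a) = c * s.
    have -> : 1 + w * a = (1 - w * c * s)^-1.
      by rewrite /a; field; rewrite gt_eqF.
    by rewrite /a invrK divfK // gt_eqF.
  rewrite -(mulrA 4) -expr_div_n e exprMn -sE; field.
  by rewrite gt_eqF.
exact: pow32_realization.
Qed.

End ThreeHalves.
End MainTheorem.

Theorem theorem1p2 (R : realType) (c alpha : R) (f : nat -> nat)
    (hc : 0 < c) (halpha : 0 < alpha)
    (hf : strictly_increasing_pos f)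
    (hlim : (n%:R : R) `^ (- alpha) * (f n)%:R @[n --> \oo] --> c) :
  (alpha = 1 -> 1 <= c ->
     burning_densities R f = `[1 / (2 * c ^+ 2), 1]%classic) /\
  (alpha = 3 / 2 ->
     burning_densities R f =
       `[0, (1 + Num.sqrt 6 * c) ^- 2]%classic).
Proof.
split => [alpha1 c1|alpha32].
  apply: linear_densities => //; apply: cvg_trans hlim; apply: near_eq_cvg.
  near=> n; rewrite alpha1 mulrC powRN powRr1 //.
apply: pow32_densities => //; apply: cvg_trans hlim; apply: near_eq_cvg.
near=> n; rewrite alpha32 mulrC powRN.
have n0 : (n%:R : R) != 0.
  by rewrite pnatr_eq0 -lt0n; near: n; exact: nbhs_infty_gt.
have -> : 3 / 2 = 1 + 2^-1 :> R by field.
by rewrite powRD ?n0 ?implybT // powRr1 // powR12_sqrt.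
Unshelve. all: by end_near. Qed.
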